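(* \textsc{Erd\H{o}s-Ko-Rado} is PPP-complete: \textsc{Collision} polynomial-time reduces to \textsc{Erd\H{o}s-Ko-Rado}, and \textsc{Erd\H{o}s-Ko-Rado} polynomial-time reduces to \textsc{Collision}.
   Context: All circuits are Boolean circuits of size polynomial in $n$. A search problem $A$ polynomial-time reduces to a search problem $B$ if there are polynomial-time computable maps $f,g$ such that for every instance $I$ of $A$, $f(I)$ is an instance of $B$, and for every solution $s$ of $f(I)$, $g(I,s)$ is a solution of $I$. \textsc{Collision}: given a poly($n$)-size circuit $C:\{0,1\}^n\to\{0,1\}^n$, find either $x$ with $C(x)=0^n$, or $x\neq y$ with $C(x)=C(y)$. PPP is the class of search problems polynomial-time reducible to \textsc{Collision}; PPP-complete means in PPP and PPP-hard (i.e. \textsc{Collision} reduces to it). \textsc{Erd\H{o}s-Ko-Rado}: the ground set is $\{0,1\}^n$. The input is a poly($n$)-size circuit $F:\{0,1\}^n\to(\{0,1\}^n)^2$, where $F(i)=(x,y)$ is meant to represent the $2$-element set $\{x,y\}$ (so $F$ represents a family of $2^n$ two-element subsets). A solution is one of: (1) an index $i$ with $F(i)=(x,x)$ for some $x$ (an invalid set); (2) two distinct indices $i\neq j$ such that $F(i)$ and $F(j)$ represent the same set (a repeated set); (3) two indices $i,j$ such that the sets represented by $F(i)$ and $F(j)$ are disjoint. *)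

(* Defs.v *)
From mathcomp Require Import all_boot.
Set Implicit Arguments. Unset Strict Implicit. Unset Printing Implicit Defensive.

Inductive sym := S0 | S1 | SB.
Inductive hmove := MoveL | MoveR | Stay.

Record TM := {
  tm_Q : finType;
  tm_start : tm_Q;
  tm_halt : tm_Q -> bool;
  tm_delta : tm_Q -> sym -> tm_Q * sym * hmove }.

(* tape = (cells left of head, nearest first; head cell; cells right of head) *)
Definition tape := (seq sym * sym * seq sym)%type.

Definition move_tape (m : hmove) (t : tape) : tape :=
  let: (l, h, r) := t in
  match m with
  | Stay => t
  | MoveL => match l with [::] => ([::], SB, h :: r) | a :: l' => (l', a, h :: r) end
  | MoveR => match r with [::] => (h :: l, SB, [::]) | a :: r' => (h :: l, a, r') end
  end.

Definition config (M : TM) := (tm_Q M * tape)%type.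

Arguments tm_delta : clear implicits.
Arguments tm_halt : clear implicits.
Arguments tm_start : clear implicits.
Definition tm_step (M : TM) (c : config M) : config M :=
  let: (q, (l, h, r)) := c in
  if tm_halt M q then c else
  let: (q', s', m) := tm_delta M q h in (q', move_tape m (l, s', r)).

Definition tm_run (M : TM) (t : nat) (c : config M) : config M := iter t (@tm_step M) c.

Arguments tm_run : clear implicits.
Definition sym_of_bool (b : bool) : sym := if b then S1 else S0.

Definition tm_init (M : TM) (w : seq bool) : config M :=
  match map sym_of_bool w with
  | [::] => (tm_start M, ([::], SB, [::]))
  | a :: r => (tm_start M, ([::], a, r))
  end.

Arguments tm_init : clear implicits.

Fixpoint read_bits (s : seq sym) : seq bool :=
  match s with
  | S0 :: s' => false :: read_bits s'
  | S1 :: s' => true :: read_bits s'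
  | _ => [::]
  end.

Definition tm_output (t : tape) : seq bool := let: (_, h, r) := t in read_bits (h :: r).

Definition computes_within (M : TM) (p : nat -> nat) (f : seq bool -> seq bool) : Prop :=
  forall w : seq bool, exists t : nat,
    t <= p (size w) /\
    tm_halt M (tm_run M t (tm_init M w)).1 /\
    tm_output (tm_run M t (tm_init M w)).2 = f w.

Definition poly_time (f : seq bool -> seq bool) : Prop :=
  exists (M : TM) (c k : nat), computes_within M (fun n => c * n ^ k + c) f.

Record SearchProblem := {
  sp_inst : Type;
  sp_sol : Type;
  sp_encI : sp_inst -> seq bool;
  sp_encS : sp_sol -> seq bool;
  sp_valid : sp_inst -> sp_sol -> Prop }.

(* A polynomial-time reduces to B: f maps instances, g maps solutions back;
   both computable in polynomial time on the encodings (g reads the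
   encoding of I followed by the encoding of s; instance encodings are
   prefix-free). *)
Definition poly_reduces (A B : SearchProblem) : Prop :=
  exists (f : sp_inst A -> sp_inst B) (g : sp_inst A -> sp_sol B -> sp_sol A),
    (exists F, poly_time F /\ forall I, F (sp_encI I) = sp_encI (f I)) /\
    (exists G, poly_time G /\
       forall I s, G (sp_encI I ++ sp_encS s) = sp_encS (g I s)) /\
    (forall I s, sp_valid (f I) s -> sp_valid I (g I s)).

(* Wires 0..n-1 are the inputs; gate k defines wire n+k and may refer   *)
(* to wires < n+k (a reference to a non-existing wire reads false).      *)

Inductive gate := GAnd of nat & nat | GOr of nat & nat | GNot of nat.

Record circuit := Circuit { c_in : nat; c_gates : seq gate; c_outs : seq nat }.

Definition gate_val (w : seq bool) (g : gate) : bool :=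
  match g with
  | GAnd i j => nth false w i && nth false w j
  | GOr i j => nth false w i || nth false w j
  | GNot i => ~~ nth false w i
  end.

Definition eval_circuit (C : circuit) (x : seq bool) : seq bool :=
  let w0 := mkseq (fun i => nth false x i) (c_in C) in
  let w := foldl (fun w g => rcons w (gate_val w g)) w0 (c_gates C) in
  map (nth false w) (c_outs C).

(* prefix-free encodings *)
Definition enc_nat (k : nat) : seq bool := rcons (nseq k true) false.
Definition enc_bits (x : seq bool) : seq bool :=
  flatten (map (fun b => [:: true; b]) x) ++ [:: false].
Definition enc_gate (g : gate) : seq bool :=
  match g with
  | GAnd i j => [:: false; false] ++ enc_nat i ++ enc_nat j
  | GOr i j => [:: false; true] ++ enc_nat i ++ enc_nat j
  | GNot i => [:: true; false] ++ enc_nat i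
  end.
Definition enc_circuit (C : circuit) : seq bool :=
  enc_nat (c_in C) ++ enc_nat (size (c_gates C)) ++ flatten (map enc_gate (c_gates C))
  ++ enc_nat (size (c_outs C)) ++ flatten (map enc_nat (c_outs C)).

Definition coll_inst := {C : circuit | size (c_outs C) == c_in C}.

Inductive coll_sol :=
  | CZero of seq bool
  | CColl of seq bool & seq bool.

Definition coll_valid (I : coll_inst) (s : coll_sol) : Prop :=
  let C := sval I in let n := c_in C in
  match s with
  | CZero x => size x = n /\ eval_circuit C x = nseq n false
  | CColl x y => size x = n /\ size y = n /\ x <> y /\ eval_circuit C x = eval_circuit C y
  end.

Definition enc_coll_sol (s : coll_sol) : seq bool :=
  match s with
  | CZero x => false :: enc_bits x
  | CColl x y => true :: enc_bits x ++ enc_bits y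
  end.

Definition Collision : SearchProblem :=
  {| sp_inst := coll_inst; sp_sol := coll_sol;
     sp_encI := fun I => enc_circuit (sval I); sp_encS := enc_coll_sol;
     sp_valid := coll_valid |}.

Definition ekr_inst := {F : circuit | size (c_outs F) == 2 * c_in F}.

Definition ekr_fst (F : circuit) (i : seq bool) : seq bool :=
  take (c_in F) (eval_circuit F i).
Definition ekr_snd (F : circuit) (i : seq bool) : seq bool :=
  drop (c_in F) (eval_circuit F i).

Inductive ekr_sol :=
  | EInvalid of seq bool
  | ERepeat of seq bool & seq bool
  | EDisjoint of seq bool & seq bool.

Definition ekr_valid (I : ekr_inst) (s : ekr_sol) : Prop :=
  let F := sval I in let n := c_in F in
  match s with
  | EInvalid i => size i = n /\ ekr_fst F i = ekr_snd F i
  | ERepeat i j =>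
      size i = n /\ size j = n /\ i <> j /\
      ((ekr_fst F i = ekr_fst F j /\ ekr_snd F i = ekr_snd F j) \/
       (ekr_fst F i = ekr_snd F j /\ ekr_snd F i = ekr_fst F j))
  | EDisjoint i j =>
      size i = n /\ size j = n /\
      ekr_fst F i <> ekr_fst F j /\ ekr_fst F i <> ekr_snd F j /\
      ekr_snd F i <> ekr_fst F j /\ ekr_snd F i <> ekr_snd F j
  end.

Definition enc_ekr_sol (s : ekr_sol) : seq bool :=
  match s with
  | EInvalid i => [:: false; false] ++ enc_bits i
  | ERepeat i j => [:: false; true] ++ enc_bits i ++ enc_bits j
  | EDisjoint i j => [:: true; false] ++ enc_bits i ++ enc_bits j
  end.

Definition ErdosKoRado : SearchProblem :=
  {| sp_inst := ekr_inst; sp_sol := ekr_sol;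
     sp_encI := fun I => enc_circuit (sval I); sp_encS := enc_ekr_sol;
     sp_valid := ekr_valid |}.

Definition in_PPP (P : SearchProblem) : Prop := poly_reduces P Collision.
Definition PPP_hard (P : SearchProblem) : Prop := poly_reduces Collision P.
Definition PPP_complete (P : SearchProblem) : Prop := in_PPP P /\ PPP_hard P.

(* Main.v *)
From HB Require Import structures.
Require Import Defs.
From mathcomp Require Import all_boot zify.
Set Implicit Arguments. Unset Strict Implicit. Unset Printing Implicit Defensive.

(* Hardness: a circuit C is sent to the family F(i) = (C(i), 0^n), in which any two
   sets meet, so that only invalid or repeated sets can be found.

   Membership: put F(0) = {v, x} and F(1) = {v, y}. If no two of the sets F(i) with i in
   {0, 1, 2, 3, j} form a solution, then v lies in F(j): otherwise F(j) = {x, y}, and at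
   most three distinct pairs meet {v, x}, {v, y} and {x, y}. Hence the circuit sending j to
   (F(j) \ v) xor v (and to 0 if v is not in F(j)) has a zero or a collision only where
   one of the pairs of indices among 0, 1, 2, 3 and the indices found is a solution.

   Polynomial time: programs of a loop language over finitely many stacks of bits, in
   which every loop runs a number of times fixed by the length of the input, are
   compiled to a machine with stacks and then to a Turing machine, whose tape holds
   the stacks one after the other, separated by blanks. *)

(** * Stack machines on one tape *)

(** The new circuit contains the centre [v] as a constant, so the instance map itself evaluates F at
    0 and 1; xor with a known bit then costs one NOT or copy gate. Among valid sets, exactly those
    avoiding [v] are sent to 0^n, since the other element of a set through [v] differs from [v]. The
    four fixed indices are distinct once n >= 2; for smaller n the indices 0 and 1 already give an
    invalid or a repeated set. The solution map does not retrace this argument: it tests every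
    candidate solution on six indices, and the argument only shows that some test succeeds.
    [poly_time] asks for one machine that halts in polynomial time on every bit string, including
    those that encode nothing. When loops are bounded by the input length alone, the time bound can
    be read off the program, and correctness is needed on encodings only. A reference to a missing
    wire reads false. Hardness uses this as a free constant; in the other direction such an output
    of F would change its value once gates are appended, and has to be redirected. *)

Definition blank_eq (s s' : seq sym) := forall i, nth SB s i = nth SB s' i.

Definition tape_eq (t t' : tape) : Prop :=
  let: (l, h, r) := t in let: (l', h', r') := t' in
  [/\ h = h', blank_eq l l' & blank_eq r r'].

(** The machine stores an explicit blank whenever it walks off the stored part of the tape, so
    configurations are tracked only up to trailing blanks. *)
Definition conf_eq (M : TM) (c c' : config M) := c.1 = c'.1 /\ tape_eq c.2 c'.2.

Lemma blank_eq_cons a s s' : blank_eq s s' -> blank_eq (a :: s) (a :: s').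
Proof. by move=> e [|i] //=. Qed.

Lemma blank_eq_behead s s' : blank_eq s s' -> blank_eq (behead s) (behead s').
Proof. by move=> e i; rewrite !nth_behead. Qed.

Lemma move_tape_eq m t t' : tape_eq t t' -> tape_eq (move_tape m t) (move_tape m t').
Proof.
case: t t' => [[l h] r] [[l' h'] r'] [<- el er].
case: m => //=.
- by case: l l' el => [|a l] [|a' l'] el //=; split;
    try (by have := el 0); try exact: blank_eq_cons; exact: (blank_eq_behead el).
- by case: r r' er => [|a r] [|a' r'] er //=; split;
    try (by have := er 0); try exact: blank_eq_cons; exact: (blank_eq_behead er).
Qed.

Lemma step_conf_eq M (c c' : config M) :
  conf_eq c c' -> conf_eq (tm_step c) (tm_step c').
Proof.
case: c c' => [q [[l h] r]] [q' [[l' h'] r']] [/= <- [<- el er]].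
case: ifP => _; first by split.
case: tm_delta => [[q2 s2] m]; split=> //.
by apply: (@move_tape_eq m (l, s2, r) (l', s2, r')); split.
Qed.

Lemma conf_eq_trans M (a b c : config M) : conf_eq a b -> conf_eq b c -> conf_eq a c.
Proof.
case: a b c => [q [[l h] r]] [q' [[l' h'] r']] [q2 [[l2 h2] r2]].
case=> /= -> [-> el er] [/= -> [-> el' er']].
by split=> //; split=> // i; rewrite ?el ?er.
Qed.

Lemma conf_eq_refl M (a : config M) : conf_eq a a.
Proof. by case: a => [q [[l h] r]]; split. Qed.

Lemma tm_output_eq t t' : tape_eq t t' -> tm_output t = tm_output t'.
Proof.
case: t t' => [[l h] r] [[l' h'] r'] [<- _ er] /=.
suff H : read_bits r = read_bits r' by rewrite H.
elim: r r' er => [|a r IH] [|a' r'] er //=.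
- by case: a' er => // /(_ 0).
- by case: a er => // /(_ 0).
- rewrite -(er 0 : a = a') (IH r') //; exact: (blank_eq_behead er).
Qed.

Definition reach (M : TM) t (c c' : config M) := conf_eq (tm_run M t c) c'.

Lemma reach_trans M t1 t2 (a b c : config M) :
  reach t1 a b -> reach t2 b c -> reach (t1 + t2) a c.
Proof.
move=> h1 h2; apply: conf_eq_trans h2; rewrite /tm_run addnC iterD -/(tm_run M t1 a).
by elim: t2 => //= n; apply: step_conf_eq.
Qed.

Lemma reach_conv M t (a b c : config M) : reach t a b -> conf_eq b c -> reach t a c.
Proof. exact: conf_eq_trans. Qed.

(** * Stack machines and the Turing machine that simulates them *)

Inductive instr (P : Type) :=
  | INop of P | IPush of nat & bool & P | IPop of nat & (option bool -> P) | IHalt.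
Arguments IHalt {P}.

Definition stacks := seq (seq bool).
Definition get (st : stacks) r := nth [::] st r.
Definition set (st : stacks) r v := set_nth [::] st r v.

Definition instr_step P (code : P -> instr P) (c : P * stacks) : P * stacks :=
  let: (p, st) := c in
  match code p with
  | INop j => (j, st)
  | IPush r b j => (j, set st r (b :: get st r))
  | IPop r j => (j (ohead (get st r)), set st r (behead (get st r)))
  | IHalt => c
  end.

Definition instr_reg P (i : instr P) :=
  match i with IPush r _ _ | IPop r _ => r | _ => 0 end.

Definition instr_next P (p : P) (i : instr P) (res : option bool) :=
  match i with IPush _ _ j => j | IPop _ j => j res | _ => p end.

#[local] Arguments move_tape : simpl never.

Section StackMachine.
Variables (k : nat) (P : finType) (code : P -> instr P).

(* The tape holds SB f_0 SB f_1 ... SB f_(k-1). A push or pop seeks the separator of its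
   stack, then inserts or deletes a symbol by shifting everything to the right of it,
   with the displaced symbol in the state. Counters are numbers of separators. *)
Inductive phase :=
  | Fetch | Seek of 'I_k.+2 | Act | Ins of option bool & 'I_k.+2 | ToEnd of 'I_k.+2
  | Del of option bool & 'I_k.+2 | Back of 'I_k.+2 & option bool.

Definition phase_enc ph : ('I_7 * 'I_k.+2 * option bool) :=
  match ph with
  | Fetch => (inord 0, inord 0, None) | Seek n => (inord 1, n, None)
  | Act => (inord 2, inord 0, None) | Ins c n => (inord 3, n, c)
  | ToEnd n => (inord 4, n, None) | Del c n => (inord 5, n, c)
  | Back n c => (inord 6, n, c)
  end.
Definition phase_dec (x : 'I_7 * 'I_k.+2 * option bool) : phase :=
  let: (t, n, c) := x in
  match nat_of_ord t with
  | 0 => Fetch | 1 => Seek n | 2 => Act | 3 => Ins c n | 4 => ToEnd n | 5 => Del c n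
  | _ => Back n c
  end.
Lemma phase_encK : cancel phase_enc phase_dec.
Proof. by case=> *; rewrite /= inordK. Qed.
HB.instance Definition _ := Finite.copy phase (can_type phase_encK).

Definition sym_of (c : option bool) := if c is Some b then sym_of_bool b else SB.
Definition of_sym a := match a with SB => None | S0 => Some false | S1 => Some true end.
Definition isB a := if a is SB then true else false.

Lemma of_symK : cancel of_sym sym_of. Proof. by case. Qed.
Lemma sym_ofK : cancel sym_of of_sym. Proof. by case=> // -[]. Qed.

Definition ctr n : 'I_k.+2 := inord n.
Definition dec a (n : 'I_k.+2) := if isB a then ctr n.-1 else n.
Definition last_sep a (n : 'I_k.+2) := isB a && (val n == 0).

(** For [Ins] and [ToEnd] the counter starts at the number [k.-1 - r] of stacks beyond stack r, so
    the blank met at 0 is the end of the tape. [Del] comes back from there with the same counter;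
    when it meets the separator of stack r, the symbol it carries is the popped bit. [Back] has to
    pass [k.-1] separators from the end of the tape, r from the separator of stack r, and r + 1 from
    the blank that follows an empty stack r. *)
Definition stm_delta (q : P * phase) (a : sym) : (P * phase) * sym * hmove :=
  let: (p, ph) := q in
  match ph with
  | Fetch => match code p with
             | INop j => ((j, Fetch), a, Stay)
             | IHalt => (q, a, Stay)
             | i => ((p, Seek (ctr (instr_reg i))), a, MoveL)
             end
  | Seek n => if last_sep a n then ((p, Act), a, MoveR) else ((p, Seek (dec a n)), a, MoveR)
  | Act => match code p with
           | IPush r b _ => ((p, Ins (Some b) (ctr (k.-1 - r))), a, Stay)
           | i => if isB a then ((p, Back (ctr (instr_reg i).+1) None), a, Stay)
                  else ((p, ToEnd (ctr (k.-1 - instr_reg i))), a, Stay)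
           end
  | Ins c n => if last_sep a n then ((p, Back (ctr k.-1) None), sym_of c, Stay)
               else ((p, Ins (of_sym a) (dec a n)), sym_of c, MoveR)
  | ToEnd n => if last_sep a n
               then ((p, Del None (ctr (k.-1 - instr_reg (code p)))), a, MoveL)
               else ((p, ToEnd (dec a n)), a, MoveR)
  | Del c n => if last_sep a n then ((p, Back (ctr (instr_reg (code p))) c), a, Stay)
               else ((p, Del (of_sym a) (dec a n)), sym_of c, MoveL)
  | Back n res => if last_sep a n then ((instr_next p (code p) res, Fetch), a, MoveR)
                  else ((p, Back (dec a n) res), a, MoveL)
  end.

Definition stm_halt (q : P * phase) :=
  if q is (p, Fetch) then (if code p is IHalt then true else false) else false.

Definition stm (p0 : P) : TM :=
  {| tm_Q := (P * phase)%type; tm_start := (p0, Fetch);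
     tm_halt := stm_halt; tm_delta := stm_delta |}.

Variable p0 : P.
Let M := stm p0.

(* The head on the first cell of the right part, resp. of the left part. *)
Definition Tr l s : tape := (l, head SB s, behead s).
Definition Tl l s : tape := (behead l, head SB l, s).

Lemma moveR_Tr l a s : move_tape MoveR (l, a, s) = Tr (a :: l) s.
Proof. by case: s. Qed.
Lemma moveL_Tl l a s : move_tape MoveL (l, a, s) = Tl l (a :: s).
Proof. by case: l. Qed.

Definition seps u := count isB u.

Lemma ctrK n : n < k.+2 -> ctr n = n :> nat.
Proof. exact: inordK. Qed.

Lemma last_sep_ctr a n : n < k.+2 -> last_sep a (ctr n) = isB a && (n == 0).
Proof. by move=> h; rewrite /last_sep /= ctrK. Qed.

Lemma dec_ctr a n : n + isB a < k.+2 -> dec a (ctr (n + isB a)) = ctr n.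
Proof. by rewrite /dec; case: isB => h; rewrite ?ctrK // ?addn1 ?addn0. Qed.

Lemma last_sep_more a n : n + isB a < k.+2 -> last_sep a (ctr (n + isB a)) = false.
Proof. by move=> h; rewrite last_sep_ctr //; case: isB h => //=; rewrite addn1. Qed.

Lemma run_step t (c : config M) : tm_run M t.+1 c = tm_run M t (tm_step c).
Proof. by rewrite /tm_run iterSr. Qed.

Lemma seek_sweep p u n l s : n + seps u < k.+2 ->
  tm_run M (size u) ((p, Seek (ctr (n + seps u))), Tr l (u ++ s)) =
  ((p, Seek (ctr n)), Tr (rev u ++ l) s).
Proof.
elim: u l => [|a u IH] l h; first by rewrite addn0.
rewrite [size _]/= run_step rev_cons cat_rcons -IH /=; last by move: h => /=; lia.
rewrite (_ : n + _ = n + seps u + isB a); last by rewrite /=; lia.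
have h' : n + seps u + isB a < k.+2 by move: h => /=; lia.
by rewrite /tm_step /= last_sep_more // dec_ctr // moveR_Tr.
Qed.

Lemma toend_sweep p u n l s : n + seps u < k.+2 ->
  tm_run M (size u) ((p, ToEnd (ctr (n + seps u))), Tr l (u ++ s)) =
  ((p, ToEnd (ctr n)), Tr (rev u ++ l) s).
Proof.
elim: u l => [|a u IH] l h; first by rewrite addn0.
rewrite [size _]/= run_step rev_cons cat_rcons -IH /=; last by move: h => /=; lia.
rewrite (_ : n + _ = n + seps u + isB a); last by rewrite /=; lia.
have h' : n + seps u + isB a < k.+2 by move: h => /=; lia.
by rewrite /tm_step /= last_sep_more // dec_ctr // moveR_Tr.
Qed.

Lemma ins_sweep p u c n l s : n + seps u < k.+2 ->
  tm_run M (size u) ((p, Ins c (ctr (n + seps u))), Tr l (u ++ s)) =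
  ((p, Ins (of_sym (last (sym_of c) u)) (ctr n)), Tr (rev (belast (sym_of c) u) ++ l) s).
Proof.
elim: u c l => [|a u IH] c l h; first by rewrite addn0 /= sym_ofK.
have h' : n + seps u + isB a < k.+2 by move: h => /=; lia.
rewrite [size _]/= run_step [belast _ _]/= rev_cons cat_rcons [last _ _]/=.
have := IH (of_sym a); rewrite of_symK => <-; last by lia.
rewrite (_ : n + _ = n + seps u + isB a); last by rewrite /=; lia.
by rewrite /tm_step /= last_sep_more // dec_ctr // moveR_Tr.
Qed.

Lemma back_sweep p u n res l s : n + seps u < k.+2 ->
  tm_run M (size u) ((p, Back (ctr (n + seps u)) res), Tl (u ++ l) s) =
  ((p, Back (ctr n) res), Tl l (catrev u s)).
Proof.
elim: u s => [|a u IH] s h; first by rewrite addn0.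
rewrite [size _]/= run_step /= -IH; last by move: h => /=; lia.
rewrite (_ : n + _ = n + seps u + isB a); last by rewrite /=; lia.
have h' : n + seps u + isB a < k.+2 by move: h => /=; lia.
by rewrite /tm_step /= last_sep_more // dec_ctr // moveL_Tl.
Qed.

Lemma del_sweep p u c n l s : n + seps u < k.+2 ->
  tm_run M (size u) ((p, Del c (ctr (n + seps u))), Tl (u ++ l) s) =
  ((p, Del (of_sym (last (sym_of c) u)) (ctr n)), Tl l (catrev (belast (sym_of c) u) s)).
Proof.
elim: u c s => [|a u IH] c s h; first by rewrite addn0 /= sym_ofK.
have h' : n + seps u + isB a < k.+2 by move: h => /=; lia.
rewrite [size _]/= run_step [belast _ _]/= [last _ _]/= [catrev _ _]/=.
have := IH (of_sym a); rewrite of_symK => <-; last by lia.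
rewrite (_ : n + _ = n + seps u + isB a); last by rewrite /=; lia.
by rewrite /tm_step /= last_sep_more // dec_ctr // moveL_Tl.
Qed.

Definition enc_stacks (st : stacks) : seq sym :=
  flatten [seq SB :: map sym_of_bool f | f <- st].

Lemma seps_bits f : seps (map sym_of_bool f) = 0.
Proof. by elim: f => //= -[]. Qed.

Lemma seps_enc st : seps (enc_stacks st) = size st.
Proof.
elim: st => //= f st IH.
by rewrite /enc_stacks /= -/(enc_stacks st) /seps count_cat -!/(seps _) seps_bits IH.
Qed.

Lemma seps_cat u v : seps (u ++ v) = seps u + seps v.
Proof. exact: count_cat. Qed.
Lemma seps_rev u : seps (rev u) = seps u.
Proof. exact: count_rev. Qed.

Lemma enc_cat s1 s2 : enc_stacks (s1 ++ s2) = enc_stacks s1 ++ enc_stacks s2.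
Proof. by rewrite /enc_stacks map_cat flatten_cat. Qed.

Lemma enc_cons f s : enc_stacks (f :: s) = SB :: map sym_of_bool f ++ enc_stacks s.
Proof. by []. Qed.

Lemma enc_head st : 0 < size st -> enc_stacks st = SB :: behead (enc_stacks st).
Proof. by case: st. Qed.

Lemma seps_behead st : seps (behead (enc_stacks st)) = (size st).-1.
Proof. by case: st => // f st; have := seps_enc (f :: st); rewrite enc_cons => -[]. Qed.

(** Between instructions the head is just right of the leftmost separator. This is the shape of the
    initial tape, where the blank left of the input is that separator and the other stacks are
    empty, and it is where the output is read; so no preparation or cleaning up is required. *)
Definition rest (st : stacks) : tape := Tr [:: SB] (behead (enc_stacks st)).

Lemma back_home p u n res s : seps u = n -> n < k.+2 ->
  tm_run M (size u).+1 ((p, Back (ctr n) res), Tl (rev (SB :: u)) s) =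
  ((instr_next p (code p) res, Fetch), Tr [:: SB] (u ++ s)).
Proof.
move=> hu hn; rewrite /tm_run iterS -/(tm_run M _ _) rev_cons -cats1.
rewrite -(size_rev u) -[n]add0n -hu -(seps_rev u) back_sweep; last by rewrite seps_rev hu.
rewrite /tm_step /= last_sep_ctr //= moveR_Tr.
by rewrite catrevE revK.
Qed.

Lemma run_reach t (c c' : config M) : tm_run M t c = c' -> reach t c c'.
Proof. by move=> <-; apply: conf_eq_refl. Qed.

Lemma reach_seek p r st1 f st2 : size st1 = r -> r < k ->
  match code p with IPush r' _ _ | IPop r' _ => r' = r | _ => False end ->
  reach (size (enc_stacks st1)).+2 (((p, Fetch), rest (st1 ++ f :: st2)) : config M)
    ((p, Act), Tr (SB :: rev (enc_stacks st1)) (map sym_of_bool f ++ enc_stacks st2)).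
Proof.
move=> hs hr hc.
rewrite -[X in reach X]add1n.
apply: (@reach_trans M _ _ _ ((p, Seek (ctr r)), Tr [::] (enc_stacks (st1 ++ f :: st2)))).
  have E t : tm_step (((p, Fetch), t) : config M) = ((p, Seek (ctr r)), move_tape MoveL t).
    by case: t => [[l h] s]; rewrite /tm_step /=; case: (code p) hc => //= r' => [b j|j] ->.
  rewrite /reach -[tm_run _ _ _]/(tm_step _) E.
  split=> //; rewrite /rest [X in Tr [::] X]enc_head ?size_cat ?addnS //.
  by split=> // -[|i] /=; rewrite ?nth0 ?nth_behead.
rewrite enc_cat enc_cons -addn1; apply: reach_trans.
  apply: run_reach; rewrite -hs -seps_enc -[seps _]add0n.
  by apply: seek_sweep; rewrite seps_enc hs; lia.
by apply: run_reach; rewrite /tm_run /= /tm_step /= last_sep_ctr //= moveR_Tr cats0.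
Qed.

Lemma macro_push p r b j st1 f st2 :
  code p = IPush r b j -> size st1 = r -> (size st1 + size st2).+1 = k ->
  exists2 t, t <= 4 * size (enc_stacks (st1 ++ f :: st2)) + 10 &
  reach t (((p, Fetch), rest (st1 ++ f :: st2)) : config M)
    ((j, Fetch), rest (st1 ++ (b :: f) :: st2)).
Proof.
move=> hc hr hk.
set u := map sym_of_bool f ++ enc_stacks st2.
set e1 := enc_stacks st1.
have hu : seps u = size st2 by rewrite seps_cat seps_bits seps_enc.
have seek := @reach_seek p r st1 f st2 hr ltac:(lia); rewrite hc in seek.
exists ((size e1).+2 + (1 + (size u + (1 + (size (behead (enc_stacks (st1 ++ (b :: f) :: st2)))).+1)))).
  rewrite size_behead !enc_cat !enc_cons !size_cat /= !size_cat size_map -/e1 /=.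
  rewrite ?size_cat ?size_map; lia.
apply: (reach_trans (seek erefl)).
apply: (@reach_trans M _ _ _ ((p, Ins (Some b) (ctr (k.-1 - r))), Tr (SB :: rev e1) u)).
  by apply: run_reach; rewrite /tm_run /= /tm_step /= hc.
rewrite -[u in Tr _ u]cats0 (_ : k.-1 - r = 0 + seps u); last by rewrite hu; lia.
apply: reach_trans.
  apply: run_reach; apply: ins_sweep; rewrite hu; lia.
apply: (@reach_trans M _ _ _ ((p, Back (ctr k.-1) None), Tl (rev (enc_stacks (st1 ++ (b :: f) :: st2))) [::])).
  apply: run_reach; rewrite /tm_run /= /tm_step /= last_sep_ctr //=.
  rewrite of_symK; set x := sym_of_bool b.
  have -> : enc_stacks (st1 ++ (b :: f) :: st2) = rcons e1 SB ++ x :: u.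
    by rewrite cat_rcons enc_cat.
  by rewrite rev_cat (lastI x u) !rev_rcons.
apply: run_reach; rewrite [X in Tl (rev X) _]enc_head ?size_cat ?addnS //.
rewrite back_home ?hc ?cats0 //=; last by lia.
by rewrite seps_behead size_cat -hk addnS.
Qed.

Lemma blank_eq_trail u n : blank_eq (u ++ nseq n SB) u.
Proof.
move=> i; rewrite nth_cat; case: ltnP => // h.
by rewrite nth_nseq if_same nth_default.
Qed.

Lemma Tr_eq q l s s' : blank_eq s s' -> conf_eq ((q, Tr l s) : config M) ((q, Tr l s') : config M).
Proof.
move=> e; split=> //=; split=> //; first by have := e 0; rewrite !nth0.
exact: blank_eq_behead.
Qed.

(** Deleting leaves additional blanks at the right end, so the final tape matches the encoding only
    up to [blank_eq]. *)
Lemma macro_pop p r j st1 f st2 :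
  code p = IPop r j -> size st1 = r -> (size st1 + size st2).+1 = k ->
  exists2 t, t <= 4 * size (enc_stacks (st1 ++ f :: st2)) + 10 &
  reach t (((p, Fetch), rest (st1 ++ f :: st2)) : config M)
    ((j (ohead f), Fetch), rest (st1 ++ behead f :: st2)).
Proof.
move=> hc hr hk.
set u := map sym_of_bool f ++ enc_stacks st2.
set e1 := enc_stacks st1.
have hu : seps u = size st2 by rewrite seps_cat seps_bits seps_enc.
have seek := @reach_seek p r st1 f st2 hr ltac:(lia); rewrite hc in seek.
have he1 : exists2 y, rcons e1 SB = SB :: y & seps y = r.
  have E : rcons e1 SB = SB :: behead (rcons e1 SB) by rewrite /e1; case: (st1).
  exists (behead (rcons e1 SB)) => //.
  have : seps (rcons e1 SB) = r.+1 by rewrite -cats1 seps_cat seps_enc hr addn1.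
  by rewrite E => -[].
case: he1 => y ey hy.
have ey1 : SB :: rev e1 = rev (SB :: y) by rewrite -ey rev_rcons.
have esz : size y = size e1 by have := congr1 size ey; rewrite size_rcons /= => -[].
case: f @u hu seek => [|b f] u hu seek.
  exists ((size e1).+2 + (1 + (size (rcons y SB)).+1)).
    rewrite size_rcons enc_cat enc_cons size_cat -/e1 esz /=; lia.
  apply: (reach_trans (seek erefl)).
  (* An empty stack shows as a blank under the head: the next separator, or the end of the tape
     after the last stack. *)
  have isBu : isB (head SB u) by rewrite /u /=; case: (st2).
  have eu : head SB u = SB by case: (head _ _) isBu.
  apply: (@reach_trans M _ _ _ ((p, Back (ctr r.+1) None), Tl (rev (SB :: rcons y SB)) (behead u))).
    apply: run_reach; rewrite /tm_run /= /tm_step /= hc -/u isBu /=.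
    by rewrite rev_cons rev_rcons /= -rev_cons -ey1 /Tl /= eu.
  apply: reach_conv; first by apply: run_reach; apply: back_home;
    rewrite -?cats1 ?seps_cat ?hy ?addn1; lia.
  rewrite hc /=; apply: Tr_eq.
  rewrite enc_cat enc_cons /= -/e1 -cat_rcons ey /= cat_rcons.
  move=> i; rewrite !nth_cat; case: ltnP => // h.
  rewrite /u /=; case: (st2) => //=; rewrite ?nth_nil.
  by case: (i - size y) => //= m; rewrite nth_nil.
exists ((size e1).+2 + (1 + (size u + (1 + (size u + (1 + (size y).+1)))))).
  rewrite enc_cat enc_cons size_cat -/e1 esz /u /= !size_cat /= ; lia.
apply: (reach_trans (seek erefl)).
apply: (@reach_trans M _ _ _ ((p, ToEnd (ctr (k.-1 - r))), Tr (SB :: rev e1) u)).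
  apply: run_reach; rewrite /tm_run /= /tm_step /= hc.
  by rewrite (_ : isB (sym_of_bool b) = false) //; case: (b).
rewrite -[u in Tr _ u]cats0 (_ : k.-1 - r = 0 + seps u); last by rewrite hu; lia.
apply: reach_trans.
  apply: run_reach; apply: toend_sweep; rewrite hu; lia.
apply: (@reach_trans M _ _ _ ((p, Del None (ctr (0 + seps (rev u)))), Tl (rev u ++ (SB :: rev e1)) [:: SB])).
  apply: run_reach; rewrite /tm_run /= /tm_step /= last_sep_ctr //= hc /= moveL_Tl seps_rev hu.
  by congr (((p, Del None (ctr _)), _)); lia.
apply: reach_trans.
  by rewrite -(size_rev u); apply: run_reach; apply: del_sweep; rewrite seps_rev hu; lia.
have edel : of_sym (last (sym_of None) (rev u)) = Some b.
  by rewrite /u /= rev_cons last_rcons (sym_ofK (Some b)).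
apply: (@reach_trans M _ _ _ ((p, Back (ctr r) (Some b)),
         Tl (rev (SB :: y)) (map sym_of_bool f ++ enc_stacks st2 ++ [:: SB; SB]))).
  apply: run_reach; rewrite /tm_run /= /tm_step /= edel last_sep_ctr //= hc /= -ey1.
  rewrite catrevE; congr (_, (_, _, _)).
  rewrite /u /= -[X in rev (belast X _)]/SB.
  set u' := map _ _ ++ _.
  have : SB :: rev (sym_of_bool b :: u') = rcons (belast SB (rev (sym_of_bool b :: u'))) (sym_of_bool b).
    by rewrite {1}lastI; congr rcons; rewrite rev_cons last_rcons.
  move/(congr1 rev); rewrite rev_rcons rev_cons revK => -[<-].
  by rewrite -cats1 /u' -!catA.
apply: reach_conv; first by apply: run_reach; apply: back_home => //; lia.
rewrite hc /=; apply: Tr_eq.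
rewrite enc_cat enc_cons /= -/e1 -[X in behead X]cat_rcons ey /= -[[:: SB; SB]]/(nseq 2 SB) !catA.
exact: blank_eq_trail.
Qed.

Hypothesis regs_lt : forall p, instr_reg (code p) < k.

Lemma split_stacks (st : stacks) r : r < size st ->
  st = take r st ++ get st r :: drop r.+1 st.
Proof. by move=> h; rewrite /get -drop_nth // cat_take_drop. Qed.

Lemma set_split (st : stacks) r v : r < size st ->
  set st r v = take r st ++ v :: drop r.+1 st.
Proof. by move=> h; rewrite /set set_nthE h. Qed.

Lemma macro_step p st : size st = k ->
  exists2 t, t <= 4 * size (enc_stacks st) + 10 &
  reach t (((p, Fetch), rest st) : config M)
    (((instr_step code (p, st)).1, Fetch), rest (instr_step code (p, st)).2).
Proof.
move=> hk; have hr := regs_lt p; rewrite /instr_step.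
case E: (code p) hr => [j|r b j|r j|] //= hr.
- exists 1; first by rewrite addnC.
  by apply: run_reach; rewrite /tm_run /= /tm_step /= E.
- have hr' : r < size st by rewrite hk.
  rewrite set_split // {1 2}(split_stacks hr').
  by apply: (macro_push _ E); rewrite ?size_takel ?size_drop; lia.
- have hr' : r < size st by rewrite hk.
  rewrite set_split // {1 2}(split_stacks hr').
  by apply: (macro_pop _ E); rewrite ?size_takel ?size_drop; lia.
- by exists 0 => //; apply: run_reach.
Qed.

Lemma size_set (st : stacks) r v : r < size st -> size (set st r v) = size st.
Proof. by move=> h; rewrite size_set_nth; apply/maxn_idPr. Qed.

Lemma instr_step_size p st : size st = k ->
  size (instr_step code (p, st)).2 = k /\
  size (enc_stacks (instr_step code (p, st)).2) <= (size (enc_stacks st)).+1.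
Proof.
move=> hk; have hr := regs_lt p; rewrite /instr_step.
case: (code p) hr => [j|r b j|r j|] //= hr; have hr' : r < size st by rewrite hk.
- rewrite size_set // set_split //; split=> //; rewrite [in X in _ <= X](split_stacks hr').
  by rewrite !enc_cat !enc_cons !size_cat /= !size_cat !size_map; lia.
- rewrite size_set // set_split //; split=> //; rewrite [in X in _ <= X](split_stacks hr').
  by rewrite !enc_cat !enc_cons !size_cat /= !size_cat !size_map size_behead; lia.
Qed.

(** An instruction costs linear time in the length of the tape and lengthens it by at most one cell,
    so T instructions cost quadratic time. *)
Lemma macro_steps T p st : size st = k ->
  exists2 t, t <= T * (4 * (size (enc_stacks st) + T) + 10) &
  reach t (((p, Fetch), rest st) : config M)
    (((iter T (instr_step code) (p, st)).1, Fetch), rest (iter T (instr_step code) (p, st)).2).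
Proof.
elim: T p st => [|T IH] p st hk; first by exists 0 => //; apply: run_reach.
have [t1 ht1 r1] := macro_step p hk.
have [hk' he] := instr_step_size p hk.
rewrite iterSr; case: (instr_step code (p, st)) r1 hk' he => p' st' r1 hk' he.
have [t2 ht2 r2] := IH p' st' hk'.
exists (t1 + t2); last exact: reach_trans r1 r2.
have : T * (4 * (size (enc_stacks st') + T) + 10) <= T * (4 * (size (enc_stacks st) + T.+1) + 10).
  by rewrite leq_mul2l; apply/orP; right; move: he => /=; lia.
by rewrite mulSn; lia.
Qed.

Lemma enc_nil n : enc_stacks (nseq n [::]) = nseq n SB.
Proof. by elim: n => //= n <-. Qed.

Lemma read_bits_enc f st : read_bits (map sym_of_bool f ++ enc_stacks st) = f.
Proof. by elim: f => [|[] f IH] /=; rewrite ?IH //; case: st. Qed.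

Lemma stm_computes T w p st : 0 < k -> code p = IHalt ->
  iter T (instr_step code) (p0, w :: nseq k.-1 [::]) = (p, st) ->
  exists t, [/\ t <= T * (4 * (size w + k + T) + 10),
    tm_halt M (tm_run M t (tm_init M w)).1 &
    tm_output (tm_run M t (tm_init M w)).2 = get st 0].
Proof.
move=> k0 hp hT.
have hk : size (w :: nseq k.-1 [::]) = k by rewrite /= size_nseq prednK.
have [t ht] := macro_steps T p0 hk; rewrite hT /= => r.
have st_k : size st = k.
  suff : size (iter T (instr_step code) (p0, w :: nseq k.-1 [::])).2 = k by rewrite hT.
  elim: T {hT ht r} => //= T; case: (iter T _ _) => p' st' /= h.
  by have [] := instr_step_size p' h.
have {}r : reach t (tm_init M w) (((p, Fetch), rest st) : config M).
  apply: (@reach_trans M 0 _ _ _ _ _ r).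
  rewrite /reach /= /tm_init /rest enc_cons enc_nil /=.
  case: w {hT ht r hk} => [|b w] /=.
    by split=> //=; split; [case: (k.-1)|case=> [|[]]|case: (k.-1) => //= n i; rewrite nth_nil nth_nseq if_same].
  split=> //=; split=> //; first by case=> [|[]].
  by move=> i; rewrite (blank_eq_trail (map sym_of_bool w)).
exists t; split.
- apply: leq_trans ht _; rewrite enc_cons enc_nil /= size_cat size_map size_nseq.
  by rewrite leq_mul2l; lia.
- by case: r => -> _; rewrite /= hp.
- case: r => _ /tm_output_eq ->; case: st st_k {hT} => [/esym|f st] _; first by move: k0; case: (k).
  rewrite /rest enc_cons /= -[RHS](read_bits_enc f st).
  by case: (_ ++ _).
Qed.

End StackMachine.

(** * Programs on stacks *)

Inductive wcmd :=
  | WNop | WPush of nat & bool | WSeq of wcmd & wcmd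
  | WCase of nat & wcmd & wcmd & wcmd
  | WLoop of nat & wcmd & wcmd.

(* [WCase] and [WLoop] pop the stack they inspect; the index counts instructions. *)
Inductive exec : wcmd -> stacks -> nat -> stacks -> Prop :=
  | ExNop st : exec WNop st 1 st
  | ExPush r b st : exec (WPush r b) st 1 (set st r (b :: get st r))
  | ExSeq c1 c2 st1 t1 st2 t2 st3 :
      exec c1 st1 t1 st2 -> exec c2 st2 t2 st3 -> exec (WSeq c1 c2) st1 (t1 + t2) st3
  | ExCase r cn c0 c1 st t st' :
      exec (match ohead (get st r) with None => cn | Some false => c0 | Some true => c1 end)
        (set st r (behead (get st r))) t st' ->
      exec (WCase r cn c0 c1) st t.+1 st'
  | ExLoopN r c0 c1 st : get st r = [::] -> exec (WLoop r c0 c1) st 1 (set st r [::])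
  | ExLoopS r c0 c1 b l st t1 st1 t2 st2 : get st r = b :: l ->
      exec (if b then c1 else c0) (set st r l) t1 st1 ->
      exec (WLoop r c0 c1) st1 t2 st2 ->
      exec (WLoop r c0 c1) st (t1 + t2).+1 st2.

(** Program points follow the syntax tree, which gives a finite type at once and avoids arithmetic
    on labels. *)
Fixpoint point (c : wcmd) : finType :=
  match c with
  | WNop | WPush _ _ => unit
  | WSeq c1 c2 => (point c1 + point c2)%type
  | WCase _ cn c0 c1 => option (point cn + (point c0 + point c1))
  | WLoop _ c0 c1 => option (point c0 + point c1)
  end.

Fixpoint entry (c : wcmd) : point c :=
  match c with
  | WNop | WPush _ _ => tt
  | WSeq c1 c2 => inl (entry c1)
  | WCase _ cn c0 c1 => None
  | WLoop _ c0 c1 => None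
  end.

Definition imap P Q (f : P -> Q) (i : instr P) : instr Q :=
  match i with
  | INop j => INop (f j) | IPush r b j => IPush r b (f j)
  | IPop r j => IPop r (f \o j) | IHalt => IHalt
  end.

(* The exit point is [None]. *)
Fixpoint compile (c : wcmd) : point c -> instr (option (point c)) :=
  match c with
  | WNop => fun _ => INop None
  | WPush r b => fun _ => IPush r b None
  | WSeq c1 c2 => fun p =>
      match p with
      | inl p => imap (fun o => Some (if o is Some q then inl q else inr (entry c2))) (compile p)
      | inr p => imap (omap inr) (compile p)
      end
  | WCase r cn c0 c1 => fun p =>
      match p with
      | None => IPop r (fun o => Some (Some match o with
                  | None => inl (entry cn) | Some false => inr (inl (entry c0))
                  | Some true => inr (inr (entry c1)) end))
      | Some (inl p) => imap (omap (fun q => Some (inl q))) (compile p)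
      | Some (inr (inl p)) => imap (omap (fun q => Some (inr (inl q)))) (compile p)
      | Some (inr (inr p)) => imap (omap (fun q => Some (inr (inr q)))) (compile p)
      end
  | WLoop r c0 c1 => fun p =>
      match p with
      | None => IPop r (fun o => omap (fun b : bool =>
                  Some (if b then inr (entry c1) else inl (entry c0))) o)
      | Some (inl p) => imap (fun o => Some (omap inl o)) (compile p)
      | Some (inr p) => imap (fun o => Some (omap inr o)) (compile p)
      end
  end.

(** [IPop] carries a function, so continuations are compared pointwise; this avoids functional
    extensionality. *)
Definition instr_eqv P (i j : instr P) :=
  match i, j with
  | INop p, INop q => p = q
  | IPush r b p, IPush r' b' q => [/\ r = r', b = b' & p = q]
  | IPop r f, IPop r' g => r = r' /\ f =1 g
  | IHalt, IHalt => True
  | _, _ => False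
  end.

Lemma instr_step_eqv P (code : P -> instr P) p i st : instr_eqv (code p) i ->
  instr_step code (p, st) = instr_step (fun _ => i) (p, st).
Proof.
rewrite /instr_step; case: (code p) i => [j|r b j|r j|] [j'|r' b' j'|r' j'|] //=.
- by move=> ->.
- by case=> -> -> ->.
- by case=> -> ->.
Qed.

(** The code of [c] sits inside the host program [code]: [phi] places its points, and [e] is where
    control goes when [c] is finished. *)
Definition embeds c P (code : P -> instr P) (phi : point c -> P) (e : P) :=
  forall p, instr_eqv (code (phi p)) (imap (fun o => if o is Some q then phi q else e) (compile p)).

Lemma instr_eqv_imap P Q R (f : P -> Q) (g : Q -> R) (h : P -> R) i (j : instr R) :
  g \o f =1 h -> instr_eqv j (imap g (imap f i)) -> instr_eqv j (imap h i).
Proof.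
move=> e; case: i j => [p|r b p|r p|] [p'|r' b' p'|r' p'|] //=.
- by rewrite -e.
- by rewrite -e.
- by case=> -> h'; split=> // x; rewrite h' /= -e.
Qed.

(** The statement quantifies over all host programs because the induction changes the exit: the
    first half of a sequence leaves to the entry of the second, and a loop body leaves to the entry
    of its loop. *)
Lemma exec_steps c st t st' : exec c st t st' ->
  forall P (code : P -> instr P) phi e, embeds code phi e ->
  iter t (instr_step code) (phi (entry c), st) = (e, st').
Proof.
elim=> {c st t st'}.
- by move=> st P code phi e /(_ tt) h; rewrite -[iter _ _ _]/(instr_step code _) (instr_step_eqv _ h).
- by move=> r b st P code phi e /(_ tt) h; rewrite -[iter _ _ _]/(instr_step code _) (instr_step_eqv _ h).
- move=> c1 c2 st1 t1 st2 t2 st3 _ IH1 _ IH2 P code phi e h.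
  rewrite addnC iterD (IH1 _ _ (phi \o inl) (phi (inr (entry c2)))); last first.
    by move=> p; move: (h (inl p)); apply: instr_eqv_imap => -[].
  apply: (IH2 _ _ (phi \o inr)) => p.
  by move: (h (inr p)); apply: instr_eqv_imap => -[].
- move=> r cn c0 c1 st t st' _ IH P code phi e h.
  rewrite iterSr (instr_step_eqv _ (h None)) /=.
  case: (ohead _) IH => [[]|] IH.
  + apply: (IH _ _ (fun q => phi (Some (inr (inr q))))) => p.
    by move: (h (Some (inr (inr p)))); apply: instr_eqv_imap => -[].
  + apply: (IH _ _ (fun q => phi (Some (inr (inl q))))) => p.
    by move: (h (Some (inr (inl p)))); apply: instr_eqv_imap => -[].
  + apply: (IH _ _ (fun q => phi (Some (inl q)))) => p.
    by move: (h (Some (inl p))); apply: instr_eqv_imap => -[].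
- by move=> r c0 c1 st e0 P code phi e h; rewrite -[iter _ _ _]/(instr_step code _) (instr_step_eqv _ (h None)) /= e0.
- move=> r c0 c1 b l st t1 st1 t2 st2 e0 _ IH1 _ IH2 P code phi e h.
  rewrite iterSr (instr_step_eqv _ (h None)) /= e0 /= addnC iterD -(IH2 _ _ phi e h).
  congr iter; case: b {e0} IH1 => IH1 /=.
  + apply: (IH1 _ _ (fun q => phi (Some (inr q)))) => p.
    by move: (h (Some (inr p))); apply: instr_eqv_imap => -[].
  + apply: (IH1 _ _ (fun q => phi (Some (inl q)))) => p.
    by move: (h (Some (inl p))); apply: instr_eqv_imap => -[].
Qed.

Fixpoint wregs (k : nat) (c : wcmd) : bool :=
  match c with
  | WNop => true
  | WPush r _ => r < k
  | WSeq c1 c2 => wregs k c1 && wregs k c2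
  | WCase r cn c0 c1 => [&& r < k, wregs k cn, wregs k c0 & wregs k c1]
  | WLoop r c0 c1 => [&& r < k, wregs k c0 & wregs k c1]
  end.

Lemma imap_reg P Q (f : P -> Q) i : instr_reg (imap f i) = instr_reg i.
Proof. by case: i. Qed.

Lemma compile_regs k c : 0 < k -> wregs k c -> forall p : point c, instr_reg (compile p) < k.
Proof.
move=> k0; elim: c => //=.
- by move=> c1 IH1 c2 IH2 /andP[h1 h2] [p|p]; rewrite imap_reg; auto.
- move=> r cn IHn c0 IH0 c1 IH1 /and4P[hr hn h0 h1] [[p|[p|p]]|] //=; rewrite imap_reg; auto.
- by move=> r c0 IH0 c1 IH1 /and3P[hr h0 h1] [[p|p]|] //=; rewrite imap_reg; auto.
Qed.

(** * Polynomial bounds *)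

Definition polynomial (p : nat -> nat) := exists c e, forall n, p n <= c * n ^ e + c.

Lemma polynomial_cst a : polynomial (fun=> a).
Proof. by exists a, 0 => n; apply: leq_addl. Qed.

Lemma polynomial_id : polynomial id.
Proof. by exists 1, 1 => n; rewrite mul1n expn1 leq_addr. Qed.

(** The [+ 1] pays for [0 ^ 0 = 1] when n and e are both 0. *)
Lemma expn_le_pow n e e' : e <= e' -> n ^ e <= n ^ e' + 1.
Proof.
case: n => [|n] h; last by apply: leq_trans (leq_addr _ _); rewrite leq_pexp2l.
by case: e h => [|e] h; [rewrite expn0; apply: leq_addl | rewrite exp0n].
Qed.

Lemma polynomialD p q : polynomial p -> polynomial q -> polynomial (fun n => p n + q n).
Proof.
move=> [c [e hp]] [d [f hq]]; exists (2 * (c + d)), (maxn e f) => n.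
have := expn_le_pow n (leq_maxl e f); have := expn_le_pow n (leq_maxr e f).
have := hp n; have := hq n; set X := n ^ maxn e f; nia.
Qed.

Lemma polynomialM p q : polynomial p -> polynomial q -> polynomial (fun n => p n * q n).
Proof.
move=> [c [e hp]] [d [f hq]]; exists (4 * c * d), (e + f) => n.
apply: leq_trans (leq_mul (hp n) (hq n)) _.
have h1 := expn_le_pow n (leq_addr f e); have h2 := expn_le_pow n (leq_addl e f).
rewrite expnD in h1 h2 *; move: (n ^ e) (n ^ f) h1 h2 => x y h1 h2.
have -> : (c * x + c) * (d * y + d) = c * d * ((x + 1) * (y + 1)) by nia.
have -> : 4 * c * d * (x * y) + 4 * c * d = c * d * (4 * (x * y) + 4) by nia.
rewrite leq_mul2l; apply/orP; right; nia.
Qed.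

Lemma exec_poly_time k c (f : seq bool -> seq bool) p : 0 < k -> wregs k c -> polynomial p ->
  (forall w, exists t st, [/\ exec c (w :: nseq k.-1 [::]) t st, t <= p (size w) & get st 0 = f w]) ->
  poly_time f.
Proof.
move=> k0 hc pp hex.
pose code (p : option (point c)) : instr (option (point c)) :=
  if p is Some q then compile q else IHalt.
have regs q : instr_reg (code q) < k by case: q => //= q; apply: compile_regs.
have emb : embeds code Some None.
  move=> q /=; case: (compile q) => [j|r b j|r j|] //=; first by case: j.
  - by case: j.
  - by split=> [|x]; [|rewrite /=; case: (j x)].
have [a [e he]] : polynomial (fun n => p n * (4 * (n + k + p n) + 10)).
  by do ![apply: polynomialM | apply: polynomialD | apply: polynomial_cst
         | apply: polynomial_id | assumption].
exists (@stm k _ code (Some (entry c))), a, e => w.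
have [t [st [hx ht hf]]] := hex w.
have [t' [h1 h2 h3]] :=
  @stm_computes k _ code (Some (entry c)) regs t w None st k0 erefl (exec_steps hx emb).
exists t'; split; last by rewrite h3.
apply: leq_trans (he _); apply: leq_trans h1 _; apply: leq_mul => //; lia.
Qed.

(** * Programs whose loops have a length fixed in advance *)

Inductive cmd :=
  | Nop | Push of nat & bool | Seq of cmd & cmd
  | Case of nat & cmd & cmd & cmd
  | Rep of cmd.

(* All loops run a number of times [N] fixed in advance, so that every program
   runs in time polynomial in [N], whatever its input. *)
Fixpoint run (N : nat) (c : cmd) (st : stacks) : stacks :=
  match c with
  | Nop => st
  | Push r b => set st r (b :: get st r)
  | Seq c1 c2 => run N c2 (run N c1 st)
  | Case r cn c0 c1 =>
      let st' := set st r (behead (get st r)) in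
      match ohead (get st r) with
      | None => run N cn st' | Some false => run N c0 st' | Some true => run N c1 st'
      end
  | Rep c => iter N (run N c) st
  end.

Fixpoint cregs (k : nat) (c : cmd) : bool :=
  match c with
  | Nop => true
  | Push r _ => r < k
  | Seq c1 c2 => cregs k c1 && cregs k c2
  | Case r cn c0 c1 => [&& r < k, cregs k cn, cregs k c0 & cregs k c1]
  | Rep c => cregs k c
  end.

Fixpoint height (c : cmd) : nat :=
  match c with
  | Nop | Push _ _ => 0
  | Seq c1 c2 => maxn (height c1) (height c2)
  | Case r cn c0 c1 => maxn (height cn) (maxn (height c0) (height c1))
  | Rep c => (height c).+1
  end.

(* A loop of height [h] counts by moving the ruler [U + 2 h] to [U + 2 h + 1] and back. *)
Fixpoint trans (U : nat) (c : cmd) : wcmd :=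
  match c with
  | Nop => WNop
  | Push r b => WPush r b
  | Seq c1 c2 => WSeq (trans U c1) (trans U c2)
  | Case r cn c0 c1 => WCase r (trans U cn) (trans U c0) (trans U c1)
  | Rep c =>
      let A := U + 2 * height c in
      let body := WSeq (WPush A.+1 true) (trans U c) in
      WSeq (WLoop A body body) (WLoop A.+1 (WPush A true) (WPush A true))
  end.

Fixpoint cost (c : cmd) (N : nat) : nat :=
  match c with
  | Nop | Push _ _ => 1
  | Seq c1 c2 => cost c1 N + cost c2 N
  | Case r cn c0 c1 => 1 + (cost cn N + (cost c0 N + cost c1 N))
  | Rep c => N * (cost c N + 2) + (1 + (N * 2 + 1))
  end.

(** One pair of rulers per nesting level suffices: a loop restores its pair before it ends, so loops
    of equal height can share it, and the loops nested inside have smaller height. *)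
Fixpoint rulers (H N : nat) : stacks :=
  if H is H'.+1 then rulers H' N ++ [:: nseq N true; [::]] else [::].

Lemma size_rulers H N : size (rulers H N) = 2 * H.
Proof. by elim: H => //= H IH; rewrite size_cat IH /=; lia. Qed.

Lemma rulers_split h H N : h < H ->
  exists R, rulers H N = rulers h N ++ [:: nseq N true, [::] & R].
Proof.
elim: H => // H IH; rewrite ltnS leq_eqVlt => /orP[/eqP ->|/IH[R e]]; first by exists [::].
by exists (R ++ [:: nseq N true; [::]]); rewrite /= e -catA.
Qed.

Lemma get_cat (s x : stacks) r : r < size s -> get (s ++ x) r = get s r.
Proof. by move=> h; rewrite /get nth_cat h. Qed.

Lemma set_cat (s x : stacks) r v : r < size s -> set (s ++ x) r v = set s r v ++ x.
Proof.
move=> h; rewrite /set; elim: s r h => [|a s IH] [|r] //= h.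
by rewrite IH.
Qed.

Lemma get_size (s x : stacks) a r : r = size s -> get (s ++ a :: x) r = a.
Proof. by move=> ->; rewrite /get nth_cat ltnn subnn. Qed.

Lemma set_size (s x : stacks) a r v : r = size s -> set (s ++ a :: x) r v = s ++ v :: x.
Proof.
by move=> ->; rewrite /set; elim: s => //= b s ->.
Qed.

Lemma get_sizeS (s x : stacks) a b r : r = (size s).+1 -> get (s ++ [:: a, b & x]) r = b.
Proof. by move=> e; rewrite -cat_rcons get_size // size_rcons. Qed.

Lemma set_sizeS (s x : stacks) a b r v : r = (size s).+1 ->
  set (s ++ [:: a, b & x]) r v = s ++ [:: a, v & x].
Proof. by move=> e; rewrite -cat_rcons set_size ?size_rcons // cat_rcons. Qed.

Lemma size_run N c st : cregs (size st) c -> size (run N c st) = size st.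
Proof.
elim: c st => //=.
- by move=> r b st h; rewrite size_set.
- by move=> c1 IH1 c2 IH2 st /andP[h1 h2]; rewrite IH2 IH1.
- move=> r cn IHn c0 IH0 c1 IH1 st /and4P[hr hn h0 h1].
  by case: ohead => [[]|]; rewrite ?(IHn, IH0, IH1) ?size_set.
- move=> c IH st h; move: (N in X in iter X) => n.
  by elim: n => //= n IHn; rewrite IH IHn.
Qed.

Lemma exec_ruler_back L i j R A : size L = A ->
  exec (WLoop A.+1 (WPush A true) (WPush A true)) (L ++ [:: nseq i true, nseq j true & R])
    (j * 2).+1 (L ++ [:: nseq (j + i) true, [::] & R]).
Proof.
move=> hL; elim: j i => [|j IH] i.
  rewrite -[X in exec _ _ _ X](@set_sizeS L R (nseq i true) [::] A.+1 [::]) ?hL //.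
  by apply: ExLoopN; rewrite get_sizeS ?hL.
have -> : (j.+1 * 2).+1 = (1 + (j * 2).+1).+1 by lia.
apply: (@ExLoopS _ _ _ true (nseq j true)); first by rewrite get_sizeS ?hL.
- exact: ExPush.
- rewrite set_sizeS ?hL // get_size // set_size //.
  by rewrite addSnnS; apply: (IH i.+1).
Qed.

(** The frame [R] makes the induction work: for a loop body it absorbs the half-consumed pair of
    rulers of the enclosing loop and all those above it, so that the body sees only full rulers of
    smaller height. *)
Lemma trans_exec U N c H st R : cregs U c -> size st = U -> height c <= H ->
  exists2 t, t <= cost c N &
    exec (trans U c) (st ++ rulers H N ++ R) t (run N c st ++ rulers H N ++ R).
Proof.
elim: c H st R => //=.
- by move=> *; exists 1 => //; apply: ExNop.
- move=> r b H st R hr hs _; exists 1 => //.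
  by rewrite -set_cat ?hs // -[in X in exec _ _ _ X](@get_cat _ (rulers H N ++ R)) ?hs //; apply: ExPush.
- move=> c1 IH1 c2 IH2 H st R /andP[h1 h2] hs; rewrite geq_max => /andP[H1 H2].
  have [t1 ht1 e1] := IH1 H st R h1 hs H1.
  have [|t2 ht2 e2] := IH2 H (run N c1 st) R h2 _ H2; first by rewrite size_run ?hs.
  by exists (t1 + t2); [lia | apply: ExSeq e1 e2].
- move=> r cn IHn c0 IH0 c1 IH1 H st R /and4P[hr hn h0 h1] hs.
  rewrite !geq_max => /and3P[Hn H0 H1].
  set st' := set st r _.
  have hs' : size st' = U by rewrite size_set ?hs.
  have [tn tn' en] := IHn H st' R hn hs' Hn.
  have [t0 t0' e0] := IH0 H st' R h0 hs' H0.
  have [t1 t1' e1] := IH1 H st' R h1 hs' H1.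
  have e t st2 : exec (match ohead (get st r) with None => trans U cn | Some false => trans U c0
       | Some true => trans U c1 end) (st' ++ rulers H N ++ R) t st2 ->
    exec (WCase r (trans U cn) (trans U c0) (trans U c1)) (st ++ rulers H N ++ R) t.+1 st2.
    by move=> h; apply: ExCase; rewrite get_cat ?hs // set_cat ?hs.
  case: (ohead _) e => [[]|] e.
  + by exists t1.+1; [lia | apply: e].
  + by exists t0.+1; [lia | apply: e].
  + by exists tn.+1; [lia | apply: e].
- move=> c IH H st R hc hs hH.
  have [R' ->] := rulers_split N hH; rewrite -!catA !cat_cons.
  set h := height c; set A := U + 2 * h.
  set body := WSeq (WPush _ _) _.
  have loop i j st1 : size st1 = U -> exists2 t, t <= i * (cost c N + 2) + 1 &
    exec (WLoop A body body) (st1 ++ rulers h N ++ [:: nseq i true, nseq j true & R' ++ R]) t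
      (iter i (run N c) st1 ++ rulers h N ++ [:: [::], nseq (i + j) true & R' ++ R]).
    elim: i j st1 => [|i IHi] j st1 h1; rewrite !catA.
      exists 1; first by [].
      rewrite -[X in exec _ _ _ X](@set_size (st1 ++ rulers h N) _ [::] A [::]) ?size_cat ?size_rulers ?h1 //.
      by apply: ExLoopN; rewrite get_size // size_cat size_rulers h1.
    have hA : A = size (st1 ++ rulers h N) by rewrite size_cat size_rulers h1.
    have [t1 ht1 e1] := IH h st1 [:: nseq i true, nseq j.+1 true & R' ++ R] hc h1 (leqnn _).
    have [|t2 ht2 e2] := IHi j.+1 (run N c st1); first by rewrite size_run ?h1.
    exists ((1 + t1) + t2).+1; first by rewrite mulSn; lia.
    apply: (@ExLoopS _ _ _ true (nseq i true)); first by rewrite get_size.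
    + rewrite /body; apply: (@ExSeq _ _ _ 1 _ t1); first exact: ExPush.
      rewrite set_size // get_sizeS -?hA // set_sizeS -?hA // -catA; exact: e1.
    + by rewrite iterSr addSnnS -catA; apply: e2.
  have [t1 ht1 e1] := loop N 0 st hs.
  exists (t1 + (N * 2).+1); first by lia.
  apply: (ExSeq e1); rewrite !catA addn0.
  have := @exec_ruler_back (iter N (run N c) st ++ rulers h N) 0 N (R' ++ R) A.
  rewrite addn0; apply.
  rewrite size_cat size_rulers; congr (_ + _).
  by rewrite -[LHS]/(size (run N (Rep c) st)) size_run ?hs.
Qed.

Fixpoint push_rulers (U H : nat) : wcmd :=
  if H is H'.+1 then WSeq (push_rulers U H') (WPush (U + 2 * H') true) else WNop.

Lemma push_rulers_exec U H n st R : size st = U ->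
  exec (push_rulers U H) (st ++ rulers H n ++ R) H.+1 (st ++ rulers H n.+1 ++ R).
Proof.
move=> hs; elim: H R => [|H IH] R /=; first exact: ExNop.
rewrite -!catA -[H.+2]addn1 /=; apply: ExSeq; first exact: IH.
rewrite !catA.
have e : U + 2 * H = size (st ++ rulers H n.+1) by rewrite size_cat size_rulers hs.
have := ExPush (U + 2 * H) true ((st ++ rulers H n.+1) ++ [:: nseq n true, [::] & R]).
by rewrite get_size // set_size.
Qed.

Fixpoint wrep n c := if n is n'.+1 then WSeq c (wrep n' c) else WNop.

(** Measuring the input consumes it, so it is poured onto the scratch stack [T] while the rulers
    grow, and poured back. The 16 additional marks ensure N >= 16, hence [16 * N ^ 2 <= N ^ 3], the
    bound needed for the longest stack that is traversed. *)
Definition setup U H :=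
  let T := U + 2 * H in
  WSeq (WLoop 0 (WSeq (WPush T false) (push_rulers U H)) (WSeq (WPush T true) (push_rulers U H)))
  (WSeq (WLoop T (WPush 0 false) (WPush 0 true)) (wrep 16 (push_rulers U H))).

Lemma setup_exec U H w : 0 < U ->
  exists2 t, t <= size w * (H + 5) + 2 + 16 * H.+2 &
  exec (setup U H) (w :: nseq (U + 2 * H) [::]) t
     ((w :: nseq U.-1 [::]) ++ rulers H (size w + 16) ++ [:: [::]]).
Proof.
move=> U0; set T := U + 2 * H; set s := nseq U.-1 [::].
have hs x : size (x :: s) = U by rewrite /= size_nseq prednK.
have hT x n : T = size ((x :: s) ++ rulers H n) by rewrite size_cat hs size_rulers.
have init : w :: nseq T [::] = (w :: s) ++ rulers H 0 ++ [:: [::]].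
  have -> : rulers H 0 = nseq (2 * H) [::].
    elim: (H) => [//|h IH]; rewrite (_ : 2 * h.+1 = 2 * h + 2); last by lia.
    by rewrite nseqD -IH.
  rewrite (_ : T = U.-1 + (2 * H + 1)) ?nseqD //; rewrite /T; lia.
pose l1 := WLoop 0 (WSeq (WPush T false) (push_rulers U H)) (WSeq (WPush T true) (push_rulers U H)).
have loop1 u n t : exec l1 ((u :: s) ++ rulers H n ++ [:: t]) (size u * (H + 3)).+1
    (([::] :: s) ++ rulers H (n + size u) ++ [:: catrev u t]).
  elim: u n t => [|b u IH] n t.
    by rewrite addn0; apply: (@ExLoopN 0 _ _ (([::] :: s) ++ rulers H n ++ [:: t])).
  have -> : size (b :: u) * (H + 3) = (1 + H.+1) + (size u * (H + 3)).+1 by rewrite /=; lia.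
  apply: (@ExLoopS _ _ _ b u _ _ ((u :: s) ++ rulers H n.+1 ++ [:: b :: t])) => //; last first.
    by have := IH n.+1 (b :: t); rewrite addSnnS.
  have e : exec (WSeq (WPush T b) (push_rulers U H)) ((u :: s) ++ rulers H n ++ [:: t]) (1 + H.+1)
     ((u :: s) ++ rulers H n.+1 ++ [:: b :: t]).
    apply: ExSeq; last by apply: push_rulers_exec.
    have := ExPush T b (((u :: s) ++ rulers H n) ++ [:: t]).
    by rewrite get_size // set_size // -!catA.
  by case: b e.
have loop2 u x n : exec (WLoop T (WPush 0 false) (WPush 0 true))
   ((x :: s) ++ rulers H n ++ [:: u]) (size u * 2).+1 ((catrev u x :: s) ++ rulers H n ++ [:: [::]]).
  elim: u x => [|b u IH] x; rewrite !catA.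
    rewrite -[X in exec _ _ _ X](@set_size _ [::] [::] T [::]) //.
    by apply: ExLoopN; rewrite get_size.
  have -> : size (b :: u) * 2 = 1 + (size u * 2).+1 by rewrite /=; lia.
  apply: (@ExLoopS _ _ _ b u _ _ (((b :: x) :: s) ++ rulers H n ++ [:: u])).
  - by rewrite get_size.
  - by rewrite set_size // -catA; case: b; apply: ExPush.
  - by rewrite -catA; apply: IH.
have l3 m x n R : exec (wrep m (push_rulers U H)) ((x :: s) ++ rulers H n ++ R)
   (m * H.+1).+1 ((x :: s) ++ rulers H (n + m) ++ R).
  elim: m n => [|m IH] n; first by rewrite addn0; apply: ExNop.
  have -> : (m.+1 * H.+1).+1 = H.+1 + (m * H.+1).+1 by lia.
  by apply: ExSeq; [apply: push_rulers_exec | rewrite -addSnnS; apply: IH].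
rewrite init; eexists; last first.
  apply: ExSeq; first exact: loop1.
  apply: ExSeq; first exact: loop2.
  rewrite add0n !catrevE !cats0 revK; exact: l3.
by rewrite catrevE cats0 size_rev; lia.
Qed.

Lemma wregs_leq k k' c : k <= k' -> wregs k c -> wregs k' c.
Proof.
move=> hk; elim: c => //=.
- by move=> r _ /leq_trans; apply.
- by move=> c1 IH1 c2 IH2 /andP[/IH1 -> /IH2 ->].
- by move=> r cn IHn c0 IH0 c1 IH1 /and4P[/leq_trans -> // /IHn -> /IH0 -> /IH1 ->].
- by move=> r c0 IH0 c1 IH1 /and3P[/leq_trans -> // /IH0 -> /IH1 ->].
Qed.

Lemma trans_regs U c : cregs U c -> wregs (U + 2 * height c) (trans U c).
Proof.
elim: c => //=.
- by move=> r _; rewrite muln0 addn0.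
- move=> c1 IH1 c2 IH2 /andP[/IH1 h1 /IH2 h2].
  by rewrite (wregs_leq _ h1) ?(wregs_leq _ h2) //; lia.
- move=> r cn IHn c0 IH0 c1 IH1 /and4P[hr /IHn hn /IH0 h0 /IH1 h1].
  by rewrite (wregs_leq _ hn) ?(wregs_leq _ h0) ?(wregs_leq _ h1) ?andbT //; lia.
- move=> c IH /IH h; rewrite (wregs_leq _ h) /=; lia.
Qed.

Lemma setup_regs U H : 0 < U -> wregs (U + 2 * H).+1 (setup U H).
Proof.
move=> U0; have h : wregs (U + 2 * H).+1 (push_rulers U H).
  suff h m : m <= H -> wregs (U + 2 * H).+1 (push_rulers U m) by apply: h.
  by elim: m => //= m IH hm; rewrite IH //=; lia.
by rewrite /= h; lia.
Qed.

Lemma polynomial_cost c : polynomial (fun n => cost c (n + 16)).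
Proof.
by elim: c => /= *; do ![apply: polynomialM | apply: polynomialD | apply: polynomial_cst
         | apply: polynomial_id | assumption].
Qed.

(** The time bound is independent of what the program does: [cost] is a polynomial in N whose degree
    is at most the nesting depth of the loops. *)
Theorem cmd_poly_time U c : 0 < U -> cregs U c ->
  poly_time (fun w => get (run (size w + 16) c (w :: nseq U.-1 [::])) 0).
Proof.
move=> U0 hc; set H := height c.
apply: (@exec_poly_time (U + 2 * H).+1 (WSeq (setup U H) (trans U c)) _
   (fun n => (n * (H + 5) + 2 + 16 * H.+2) + cost c (n + 16))) => //.
- rewrite -[wregs _ _]/(wregs _ (setup U H) && wregs _ (trans U c)) setup_regs //.
  exact: wregs_leq (trans_regs hc).
- by do ![apply: polynomialM | apply: polynomialD | apply: polynomial_cst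
         | apply: polynomial_id | apply: polynomial_cost].
move=> w; have [t1 ht1 e1] := @setup_exec U H w U0.
have hs : size (w :: nseq U.-1 [::]) = U by rewrite /= size_nseq prednK.
have [t2 ht2 e2] := @trans_exec U (size w + 16) c H _ [:: [::]] hc hs (leqnn _).
exists (t1 + t2), (run (size w + 16) c (w :: nseq U.-1 [::]) ++ rulers H (size w + 16) ++ [:: [::]]).
split; [exact: ExSeq e1 e2 | lia |].
by rewrite get_cat // size_run hs.
Qed.

(** * Parsing and evaluating circuits *)

Lemma get_set st r v q : get (set st r v) q = if q == r then v else get st q.
Proof. by rewrite /get /set nth_set_nth. Qed.

Lemma set_set st r v v' : set (set st r v) r v' = set st r v'.
Proof. by rewrite /set set_set_nth eqxx. Qed.

Lemma set_setC st r q v v' : r != q -> set (set st r v) q v' = set (set st q v') r v.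
Proof. by move=> h; rewrite /set set_set_nth (negPf h). Qed.

Lemma set_get st r : r < size st -> set st r (get st r) = st.
Proof. by move=> h; rewrite set_split // -split_stacks. Qed.

Declare Scope cmd_scope.
Delimit Scope cmd_scope with cmd.
Notation "c1 ;; c2" := (Seq c1 c2) (at level 61, right associativity) : cmd_scope.
Open Scope cmd_scope.

(** A circuit with linearly many gates has a code of quadratic length, since wires are coded in
    unary. Three nested loops give N^3 rounds, enough to traverse such a stack for N large enough to
    absorb the constant. *)
Definition Loop c := Rep (Rep (Rep c)).
Definition Foreach r c0 c1 := Loop (Case r Nop c0 c1).
Definition Pop r := Case r Nop Nop Nop.
Definition Clear r := Foreach r Nop Nop.
Definition Move s d := Foreach s (Push d false) (Push d true).
(* [App s t d] prepends a copy of [s] to [d], using the empty stack [t]. *)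
Definition App s t d :=
  Move s t ;; Foreach t (Push s false ;; Push d false) (Push s true ;; Push d true).

Arguments run : simpl never.

Section Programs.
Variable N : nat.
Notation K := (N * N * N).

Lemma run_seq c1 c2 st : run N (c1 ;; c2) st = run N c2 (run N c1 st). Proof. by []. Qed.
Lemma run_push r b st : run N (Push r b) st = set st r (b :: get st r). Proof. by []. Qed.
Lemma run_case r cn c0 c1 st : run N (Case r cn c0 c1) st =
  run N (match ohead (get st r) with None => cn | Some false => c0 | Some true => c1 end)
    (set st r (behead (get st r))).
Proof. by rewrite {1}/run -/run; case: ohead => [[]|]. Qed.

Lemma iter_mul T (f : T -> T) n m x : iter n (iter m f) x = iter (n * m) f x.
Proof. by elim: n => //= n ->; rewrite -iterD. Qed.

Lemma run_loop c st : run N (Loop c) st = iter K (run N c) st.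
Proof. by rewrite -!iter_mul. Qed.

Lemma iter_stable T (f : T -> T) j k x y : iter j f x = y -> f y = y -> j <= k -> iter k f x = y.
Proof.
move=> <- h /subnK <-; rewrite iterD.
by elim: (k - j) => //= n ->.
Qed.

(** Once the stack is empty the body does nothing, so surplus rounds are harmless and only
    [size gs <= K] matters. The items [gs] may be richer than the bits driving the loop: with a
    constant [bit] the stack is a mere counter, and the items describe what is read or written
    meanwhile. *)
Lemma run_foreach T A (bit : T -> bool) (mk : seq T -> A -> stacks)
    (Inv : seq T -> A -> Prop) f r c0 c1 gs a :
  (forall gs a, get (mk gs a) r = map bit gs) ->
  (forall a, set (mk [::] a) r [::] = mk [::] a) ->
  (forall g gs a, Inv (g :: gs) a -> Inv gs (f a g) /\
     run N (if bit g then c1 else c0) (set (mk (g :: gs) a) r (map bit gs)) = mk gs (f a g)) ->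
  Inv gs a -> size gs <= K -> run N (Foreach r c0 c1) (mk gs a) = mk [::] (foldl f a gs).
Proof.
move=> hget hset hbody hI hs; rewrite run_loop; apply: (@iter_stable _ _ (size gs)) => //; last first.
  by rewrite run_case hget /= hset.
elim: gs a hI {hs} => // g gs IH a hI; rewrite [size _]/= iterSr run_case hget /=.
have [hI' h] := hbody _ _ _ hI.
by rewrite -IH // -h; case: (bit g).
Qed.

Lemma foldl_catrev T (l a : seq T) : foldl (fun a b => b :: a) a l = catrev l a.
Proof. by elim: l a => //= b l IH a. Qed.

Lemma catrev_nseq T n (x : T) l : catrev (nseq n x) l = nseq n x ++ l.
Proof. by rewrite catrevE rev_nseq. Qed.

Lemma run_clear st r : r < size st -> size (get st r) <= K -> run N (Clear r) st = set st r [::].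
Proof.
move=> hr hK; rewrite -{1}(set_get hr).
apply: (@run_foreach _ unit id (fun l _ => set st r l) (fun _ _ => True) (fun a _ => a) _ _ _ _ tt) => //.
- by move=> l _; rewrite get_set eqxx map_id.
- by move=> _; rewrite set_set.
- by move=> b l [] _; rewrite if_same map_id set_set.
Qed.

Lemma run_move st s d : s < size st -> d < size st -> s != d -> size (get st s) <= K ->
  run N (Move s d) st = set (set st s [::]) d (catrev (get st s) (get st d)).
Proof.
move=> hs hd sd hK.
have e : st = set (set st s (get st s)) d (get st d) by rewrite set_get // set_get.
rewrite {1}e -foldl_catrev.
apply: (@run_foreach _ _ id (fun l a => set (set st s l) d a) (fun _ _ => True)) => //.
- by move=> l a; rewrite !get_set (negPf sd) eqxx map_id.
- by move=> a; rewrite set_setC 1?eq_sym // set_set set_setC // eq_sym.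
- move=> b l a _; split=> //; rewrite map_id [set _ s l]set_setC 1?eq_sym // set_set.
  by case: b; rewrite run_push !get_set eqxx set_set.
Qed.

Lemma run_app st s t d : s < size st -> t < size st -> d < size st -> uniq [:: s; t; d] ->
  get st t = [::] -> size (get st s) <= K ->
  run N (App s t d) st = set st d (get st s ++ get st d).
Proof.
move=> hs ht hd /=; rewrite !inE negb_or andbT => /andP[/andP[st' sd] td] e hK.
rewrite /App run_seq run_move // e.
pose mk l (a : seq bool * seq bool) := set (set (set st t l) s a.1) d a.2.
have -> : set (set st s [::]) t (catrev (get st s) [::]) =
  mk (rev (get st s)) ([::], get st d).
  by rewrite /mk /= [set (set st t _) _ _]set_setC 1?eq_sym // -{1}(set_get hd) /rev
     ![set (set st d _) _ _]set_setC ?[set (set _ d _) _ _]set_setC // eq_sym.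
rewrite (@run_foreach _ _ id mk (fun _ _ => True) (fun a b => (b :: a.1, b :: a.2))) //.
- have -> l a : foldl (fun a b => (b :: a.1, b :: a.2)) a l = (catrev l a.1, catrev l a.2) :> (seq bool * seq bool).
    by elim: l a => [[]|b l IH a] //=; rewrite IH.
  rewrite /mk /= !catrevE revK cats0; congr set.
  by rewrite -{1}e set_get // set_get.
- by move=> l a; rewrite /mk !get_set (negPf td) eq_sym (negPf st') eqxx map_id.
- by move=> a; rewrite /mk /= set_setC 1?eq_sym // [set (set _ s _) _ _]set_setC // set_set.
- move=> b l [x y] _; split=> //; rewrite map_id /mk /=.
  rewrite [set _ t l]set_setC 1?eq_sym // [set (set _ s _) t _]set_setC // set_set.
  set st1 := set st t l.
  have -> : (if b then Push s true;; Push d true else Push s false;; Push d false) = (Push s b ;; Push d b).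
    by case: b.
  rewrite run_seq !run_push !get_set !eqxx (negPf sd) eq_sym (negPf sd).
  by rewrite [set _ s (b :: x)]set_setC 1?eq_sym // !set_set.
- by rewrite size_rev.
Qed.

Lemma run_seqE c1 c2 st st1 st2 :
  run N c1 st = st1 -> run N c2 st1 = st2 -> run N (c1 ;; c2) st = st2.
Proof. by move=> <- <-. Qed.

Lemma nseq_rcons T n (x : T) l : nseq n x ++ x :: l = x :: nseq n x ++ l.
Proof. by elim: n => //= n ->. Qed.

(* Registers: 0 input and output, 1 stream being parsed, 2 argument, 3 number of
   inputs, 4 number of gates, 5 loop counter, 6 wires, 7 reversed transcript of
   the stream, 8 current index, 9 flags, 10 code of the gates, 11 code of the
   outputs, 12 reversed output values, 13-15 scratch (empty between commands). *)
Definition regs i s p n m c w t x f g o v (tl : stacks) : stacks :=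
  [:: i, s, p, n, m, c, w, t, x, f, g, o, v, [::], [::], [::] & tl].

Ltac simst := rewrite /regs /set /get /=.
Ltac step L := eapply run_seqE; [eapply L; try done | simst].
Ltac fin L := eapply etrans; [eapply L; try done | simst].

(** Register 15 holds one bit as long as the number goes on: each round consumes it, a 1 puts it
    back, and after the closing 0 all further rounds are idle. *)
Definition RdNat :=
  Push 15 true ;; Loop (Case 15 Nop Nop
    (Case 1 Nop (Push 7 false) (Push 7 true ;; Push 8 true ;; Push 15 true))).

Lemma run_rdnat k i rest p n m c w t x f g o v tl : k < K ->
  run N RdNat (regs i (enc_nat k ++ rest) p n m c w t x f g o v tl) =
  regs i rest p n m c w (catrev (enc_nat k) t) (nseq k true ++ x) f g o v tl.
Proof.
move=> hk; rewrite /RdNat run_seq run_loop; apply: (iter_stable _ _ hk) => //.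
elim: k t x {hk} => [|k IH] t x //=.
by rewrite -iterS iterSr -nseq_rcons -(IH (true :: t) (true :: x)).
Qed.

(** Popping an empty stack leaves it empty, so a missing wire yields false, in agreement with
    [nth false]. *)
Definition Lookup :=
  App 6 14 13 ;; Foreach 8 (Pop 13) (Pop 13) ;;
  Case 13 (Push 9 false) (Push 9 false) (Push 9 true) ;; Clear 13.

Lemma run_pops s p i n m c w t x f g o v y tl : size x <= K ->
  run N (Foreach 8 (Pop 13) (Pop 13))
    [:: i, s, p, n, m, c, w, t, x, f, g, o, v, y, [::], [::] & tl] =
    [:: i, s, p, n, m, c, w, t, [::], f, g, o, v, drop (size x) y, [::], [::] & tl].
Proof.
move=> hx.
pose mk (x y : seq bool) := [:: i, s, p, n, m, c, w, t, x, f, g, o, v, y, [::], [::] & tl].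
have -> : drop (size x) y = foldl (fun y _ => behead y) y x.
  by elim: x y {hx} => [|b x IH] [|a y] //=; rewrite ?drop0 // -IH.
apply: (@run_foreach _ _ id mk (fun _ _ => True)) => //.
- by move=> l a; rewrite map_id.
- by move=> b l a _; split=> //; rewrite if_same map_id; case: a => [|[] a].
Qed.

Lemma run_lookup s p i n m c w t x f g o v tl : size w <= K -> size x <= K ->
  run N Lookup (regs i s p n m c w t x f g o v tl) =
  regs i s p n m c w t [::] (nth false w (size x) :: f) g o v tl.
Proof.
move=> hw hx; rewrite /Lookup; step run_app; step run_pops; rewrite ?cats0.
have hd : size (drop (size x) w) <= K by rewrite size_drop; lia.
eapply run_seqE; first by rewrite run_case.
simst; have := nth_drop (size x) false w 0; rewrite addn0 => <-.
by case: (drop _ _) hd => [|[] l] hd; rewrite run_push; simst; fin run_clear; try exact: ltnW hd.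
Qed.

Definition Wire := RdNat ;; Lookup.

Lemma run_wire k i rest p n m c w t f g o v tl : k < K -> size w <= K ->
  run N Wire (regs i (enc_nat k ++ rest) p n m c w t [::] f g o v tl) =
  regs i rest p n m c w (catrev (enc_nat k) t) [::] (nth false w k :: f) g o v tl.
Proof.
move=> hk hw; rewrite /Wire; step run_rdnat; fin run_lookup; rewrite ?cats0 ?size_nseq //.
exact: ltnW.
Qed.

Definition NotF := Case 9 Nop (Push 9 true) (Push 9 false).
Definition AndF := Case 9 Nop (Case 9 Nop (Push 9 false) (Push 9 false))
                              (Case 9 Nop (Push 9 false) (Push 9 true)).
Definition OrF := Case 9 Nop (Case 9 Nop (Push 9 false) (Push 9 true))
                             (Case 9 Nop (Push 9 true) (Push 9 true)).
Definition RdBit c0 c1 := Case 1 Nop (Push 7 false ;; c0) (Push 7 true ;; c1).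
(** Wires are kept in increasing order, so a new one belongs at the bottom of the stack, which is
    reached by reversing onto register 13 and back. *)
Definition AddWire := Move 6 13 ;; Case 9 Nop (Push 13 false) (Push 13 true) ;; Move 13 6.
Definition Gate :=
  RdBit (RdBit (Wire ;; Wire ;; AndF) (Wire ;; Wire ;; OrF)) (RdBit (Wire ;; NotF) Nop) ;;
  AddWire.

Lemma run_addwire i s p n m c w t x b f g o v tl : size w < K ->
  run N AddWire (regs i s p n m c w t x (b :: f) g o v tl) =
  regs i s p n m c (rcons w b) t x f g o v tl.
Proof.
move=> hw; rewrite /AddWire; step run_move; first exact: ltnW.
eapply run_seqE; first by rewrite run_case; simst.
by case: b; rewrite run_push; simst; fin run_move; rewrite ?catrevE ?cats0 //=;
  rewrite ?size_rev ?revK ?cats1.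
Qed.

Definition gate_bound (g : gate) :=
  match g with GAnd i j | GOr i j => maxn i j | GNot i => i end.

Lemma run_gate gt i rest p n m c w t g o v tl : gate_bound gt < K -> size w < K ->
  run N Gate (regs i (enc_gate gt ++ rest) p n m c w t [::] [::] g o v tl) =
  regs i rest p n m c (rcons w (gate_val w gt)) (catrev (enc_gate gt) t) [::] [::] g o v tl.
Proof.
move=> hb hw; have hw' := ltnW hw; rewrite /Gate; apply: run_seqE; last exact: run_addwire.
case: gt hb => [a b|a b|a] /= hb; rewrite -?catA.
- rewrite /RdBit run_case; simst; step run_push; rewrite run_case; simst; step run_push.
  step run_wire; first by lia.
  step run_wire; first by lia.
  rewrite !catrevE !rev_cat /= -!catA.
  by case: (nth false w a); case: (nth false w b).
- rewrite /RdBit run_case; simst; step run_push; rewrite run_case; simst; step run_push.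
  step run_wire; first by lia.
  step run_wire; first by lia.
  rewrite !catrevE !rev_cat /= -!catA.
  by case: (nth false w a); case: (nth false w b).
- rewrite /RdBit run_case; simst; step run_push; rewrite run_case; simst; step run_push.
  step run_wire.
  by case: (nth false w a).
Qed.

(** The normalisation that [eval_circuit] applies to its input: truncation, or padding with
    false. *)
Definition resize n (p : seq bool) := mkseq (nth false p) n.
Definition wires C p :=
  foldl (fun w g => rcons w (gate_val w g)) (resize (c_in C) p) (c_gates C).

Definition Resize :=
  App 3 14 5 ;;
  Foreach 5 (Case 2 (Push 13 false) (Push 13 false) (Push 13 true))
            (Case 2 (Push 13 false) (Push 13 false) (Push 13 true)) ;;
  Clear 2.

Lemma resizeS n p : resize n.+1 p = head false p :: resize n (behead p).
Proof.
rewrite /resize /mkseq /= nth0 -[1]addn0 iotaDl -map_comp; congr cons.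
by apply: eq_map => j /=; rewrite nth_behead.
Qed.

Lemma nseq_map T (gs : seq T) : nseq (size gs) true = map xpredT gs.
Proof. by elim: gs => //= g gs ->. Qed.

Lemma run_resize k s p i m w t x f g o v tl : k <= K -> size p <= K ->
  run N Resize (regs i s p (nseq k true) m [::] w t x f g o v tl) =
  [:: i, s, [::], nseq k true, m, [::], w, t, x, f, g, o, v, rev (resize k p), [::], [::] & tl].
Proof.
move=> hk hp; rewrite /Resize; step run_app; first by rewrite size_nseq.
rewrite cats0.
pose mk (l : seq bool) (a : seq bool * seq bool) :=
  [:: i, s, a.1, nseq k true, m, l, w, t, x, f, g, o, v, a.2, [::], [::] & tl].
pose h (a : seq bool * seq bool) (_ : bool) := (behead a.1, head false a.1 :: a.2).
eapply run_seqE.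
  apply: (@run_foreach _ _ id mk (fun _ _ => True) h _ _ _ (nseq k true) (p, [::])) => //.
  - by move=> l a; rewrite map_id.
  - by move=> b l [[|[] q] y] _; split=> //; rewrite if_same map_id.
  - by rewrite size_nseq.
have -> y : foldl h (p, y) (nseq k true) = (drop k p, catrev (resize k p) y).
  elim: k p y {mk hk hp} => [|k IH] p y; first by rewrite drop0.
  by rewrite resizeS /= /h /= IH; case: p.
by fin run_clear; first by rewrite size_drop; lia.
Qed.

Definition Output := Wire ;; Case 9 Nop (Push 12 false) (Push 12 true).
(** Parsing and evaluation at the point in register 2 happen together. The transcripts are kept
    because the new circuits reuse the old gates verbatim and the old output list verbatim or as a
    stream. *)
Definition Parse :=
  RdNat ;; Move 8 3 ;; RdNat ;; Move 8 4 ;; Clear 7 ;; Resize ;; Move 13 6 ;;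
  App 4 14 5 ;; Foreach 5 Gate Gate ;; Move 7 10 ;;
  RdNat ;; Move 8 5 ;; Clear 7 ;; Foreach 5 Output Output ;; Move 7 11.

Lemma size_enc_nat k : size (enc_nat k) = k.+1.
Proof. by rewrite size_rcons size_nseq. Qed.

(** Unary coding bounds every wire index by the length of the input; this is what makes the fixed
    number of rounds sufficient for reading and looking up a wire. *)
Lemma gate_bound_size g : gate_bound g < size (enc_gate g).
Proof. by case: g => [a b|a b|a]; rewrite /= ?size_cat ?size_enc_nat /=; lia. Qed.

Lemma all_size_flatten T (e : T -> seq bool) gs :
  all (fun g => size (e g) <= size (flatten (map e gs))) gs.
Proof.
elim: gs => //= g gs IH; rewrite size_cat leq_addr /=.
by apply: sub_all IH => h /leq_trans; apply; rewrite leq_addl.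
Qed.

Lemma run_gates gs i rest p n m w t g o v tl :
  all (fun g => gate_bound g < K) gs -> size w + size gs <= K ->
  run N (Foreach 5 Gate Gate)
    (regs i (flatten (map enc_gate gs) ++ rest) p n m (nseq (size gs) true) w t [::] [::] g o v tl) =
  regs i rest p n m [::] (foldl (fun w g => rcons w (gate_val w g)) w gs)
    (catrev (flatten (map enc_gate gs)) t) [::] [::] g o v tl.
Proof.
move=> hb hs; rewrite nseq_map.
pose mk gs (a : seq bool * seq bool) :=
  regs i (flatten (map enc_gate gs) ++ rest) p n m (map xpredT gs) a.1 a.2 [::] [::] g o v tl.
pose h (a : seq bool * seq bool) g := (rcons a.1 (gate_val a.1 g), catrev (enc_gate g) a.2).
transitivity (mk [::] (foldl h (w, t) gs)).
  apply: (@run_foreach _ _ xpredT mk (fun gs a => all (fun g => gate_bound g < K) gs /\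
    size a.1 + size gs <= K) h _ _ _ gs (w, t)) => //; last by lia.
  move=> g0 gs' [w' t'] [/= /andP[h1 h2] h3]; split; first by rewrite size_rcons; split => //; lia.
  by rewrite /mk -[RHS](@run_gate g0) //; [simst; rewrite -catA | move: h3 => /=; lia].
have -> : foldl h (w, t) gs = (foldl (fun w g => rcons w (gate_val w g)) w gs,
   catrev (flatten (map enc_gate gs)) t).
  elim: gs w t {hb hs} => //= g0 gs IH w t; rewrite {2}/h IH /=.
  by rewrite !catrevE rev_cat -catA.
by [].
Qed.

Lemma run_outputs os i rest p n m w t g o v tl :
  all (fun k => k < K) os -> size w <= K -> size os <= K ->
  run N (Foreach 5 Output Output)
    (regs i (flatten (map enc_nat os) ++ rest) p n m (nseq (size os) true) w t [::] [::] g o v tl) =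
  regs i rest p n m [::] w (catrev (flatten (map enc_nat os)) t) [::] [::] g o
    (catrev (map (nth false w) os) v) tl.
Proof.
move=> hb hs hos; rewrite nseq_map.
pose mk gs (a : seq bool * seq bool) :=
  regs i (flatten (map enc_nat gs) ++ rest) p n m (map xpredT gs) w a.1 [::] [::] g o a.2 tl.
pose h (a : seq bool * seq bool) k := (catrev (enc_nat k) a.1, nth false w k :: a.2).
transitivity (mk [::] (foldl h (t, v) os)).
  apply: (@run_foreach _ _ xpredT mk (fun os _ => all (fun k => k < K) os) h _ _ _ os (t, v)) => //.
  move=> k os' [t' v'] /= /andP[h1 h2]; split => //.
  rewrite /mk /Output /= -catA; step run_wire.
  by case: (nth false w k).
have -> : foldl h (t, v) os = (catrev (flatten (map enc_nat os)) t, catrev (map (nth false w) os) v).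
  elim: os t v {hb hos} => //= k os IH t v; rewrite {2}/h IH /=.
  by rewrite !catrevE rev_cat -catA.
by [].
Qed.

Lemma size_wires C p : size (wires C p) = c_in C + size (c_gates C).
Proof.
rewrite /wires -[c_in C in RHS](size_mkseq (nth false p)) -/(resize _ p).
by elim: (c_gates C) (resize _ p) => [|g gs IH] w /=; rewrite ?addn0 // IH size_rcons addSnnS.
Qed.

Lemma size_enc_circuit C : size (enc_circuit C) =
  (c_in C).+1 + ((size (c_gates C)).+1 + (size (flatten (map enc_gate (c_gates C))) +
  ((size (c_outs C)).+1 + size (flatten (map enc_nat (c_outs C)))))).
Proof. by rewrite /enc_circuit !size_cat !size_enc_nat. Qed.

Lemma leqNK : N <= K.
Proof. by case: N => // n; rewrite -mulnA leq_pmulr. Qed.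

Lemma run_parse C i rest p tl : size (enc_circuit C) <= N -> size p <= K ->
  run N Parse (regs i (enc_circuit C ++ rest) p [::] [::] [::] [::] [::] [::] [::] [::] [::] [::] tl) =
  regs i rest [::] (nseq (c_in C) true) (nseq (size (c_gates C)) true) [::] (wires C p) [::] [::] [::]
    (flatten (map enc_gate (c_gates C))) (flatten (map enc_nat (c_outs C)))
    (rev (eval_circuit C p)) tl.
Proof.
move=> hN hp; have NK := leqNK; rewrite size_enc_circuit in hN.
have hg : all (fun g => gate_bound g < K) (c_gates C).
  apply: sub_all (all_size_flatten enc_gate (c_gates C)) => g hgs.
  by have := gate_bound_size g; lia.
have ho : all (fun k => k < K) (c_outs C).
  by apply: sub_all (all_size_flatten enc_nat (c_outs C)) => k; rewrite size_enc_nat; lia.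
rewrite /Parse /enc_circuit -!catA.
step run_rdnat; first by lia.
rewrite cats0; step run_move; first by rewrite size_nseq; lia.
rewrite catrev_nseq cats0; step run_rdnat; first by lia.
rewrite cats0; step run_move; first by rewrite size_nseq; lia.
rewrite catrev_nseq cats0.
step run_clear; first by rewrite !catrevE !size_cat !size_rev !size_enc_nat /=; lia.
step run_resize; first by lia.
step run_move; first by rewrite size_rev size_mkseq; lia.
rewrite catrevE cats0 revK.
step run_app; first by rewrite size_nseq; lia.
rewrite cats0; step run_gates; first by rewrite size_mkseq; lia.
step run_move; first by rewrite catrevE size_cat size_rev /=; lia.
rewrite !catrevE !cats0 revK.
step run_rdnat; first by lia.
rewrite cats0; step run_move; first by rewrite size_nseq; lia.
rewrite catrev_nseq cats0.
step run_clear; first by rewrite !catrevE !size_cat !size_rev !size_enc_nat /=; lia.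
have hw := size_wires C p; rewrite -/(wires C p) in hw *.
rewrite -[flatten (map enc_nat _) ++ rest]/(_ ++ rest).
step run_outputs; try lia.
fin run_move; first by rewrite catrevE size_cat size_rev /=; lia.
by rewrite !catrevE !cats0 revK.
Qed.

(** * Programs for the reductions *)

Ltac side := try done; try (rewrite /regs /get /set /=; lia); try (rewrite /regs /get /set /= ?size_nseq ?size_rev ?size_cat ?size_nseq /=; lia).
Ltac go L := eapply run_seqE; [eapply L; side | simst].
Ltac gofin L := eapply etrans; [eapply L; side | simst].

Fixpoint repeat_cmd k c := if k is k'.+1 then c ;; repeat_cmd k' c else Nop.

(* [(c, k, e)] denotes the wire [n + m + k * n + c], plus the loop index if [e]. *)
Definition wref := (nat * nat * bool)%type.
Definition wref_val n m j (a : wref) := n + m + a.1.2 * n + a.1.1 + (if a.2 then j else 0).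

(** Register 0 is built by prepending, so all output is produced from its end: a number starts with
    its closing 0, and a gate with its second argument. *)
Definition EmitRef (a : wref) :=
  Push 0 false ;; repeat_cmd a.1.1 (Push 0 true) ;; repeat_cmd a.1.2.+1 (App 3 14 0) ;;
  App 4 14 0 ;; (if a.2 then App 5 14 0 else Nop).

Lemma cat_enc_nat a b i : nseq a true ++ enc_nat b ++ i = enc_nat (a + b) ++ i.
Proof. by rewrite catA /enc_nat -rcons_cat -nseqD. Qed.

Lemma cat_false_enc_nat a i : nseq a true ++ false :: i = enc_nat a ++ i.
Proof. by rewrite /enc_nat cat_rcons. Qed.

Lemma run_emit_ref a n m j i s p w t x f g o v tl : n <= K -> m <= K -> j <= K ->
  run N (EmitRef a) (regs i s p (nseq n true) (nseq m true) (nseq j true) w t x f g o v tl) =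
  regs (enc_nat (wref_val n m j a) ++ i) s p (nseq n true) (nseq m true) (nseq j true) w t x f g o v tl.
Proof.
move=> hn hm hj; rewrite /EmitRef; step run_push.
rewrite -[false :: i]/(enc_nat 0 ++ i).
have h1 k b : run N (repeat_cmd k (Push 0 true)) (regs (enc_nat b ++ i) s p (nseq n true) (nseq m true) (nseq j true) w t x f g o v tl) = regs (enc_nat (k + b) ++ i) s p (nseq n true) (nseq m true) (nseq j true) w t x f g o v tl.
  elim: k b => //= k IH b; step run_push.
  by have := IH b.+1; rewrite addnS.
have h2 k b : run N (repeat_cmd k (App 3 14 0)) (regs (enc_nat b ++ i) s p (nseq n true) (nseq m true) (nseq j true) w t x f g o v tl) = regs (enc_nat (k * n + b) ++ i) s p (nseq n true) (nseq m true) (nseq j true) w t x f g o v tl.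
  elim: k b => //= k IH b; step run_app; first by rewrite size_nseq.
  by rewrite cat_enc_nat mulSn -addnA addnCA; apply: IH.
eapply run_seqE; first exact: h1.
eapply run_seqE; first exact: (h2 a.1.2.+1).
step run_app; first by rewrite size_nseq.
rewrite cat_enc_nat; case: a => [[c k] []] /=; rewrite /wref_val /=.
- fin run_app; first by rewrite size_nseq.
  by rewrite cat_enc_nat (_ : j + _ = n + m + k * n + c + j) //; lia.
- by rewrite (_ : m + _ = n + m + k * n + c + 0) //; lia.
Qed.

Inductive tgate := TAnd of wref & wref | TOr of wref & wref | TNot of wref.
Definition tgate_val n m j g :=
  match g with
  | TAnd a b => GAnd (wref_val n m j a) (wref_val n m j b)
  | TOr a b => GOr (wref_val n m j a) (wref_val n m j b)
  | TNot a => GNot (wref_val n m j a)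
  end.

Definition EmitGate g :=
  match g with
  | TAnd a b => EmitRef b ;; EmitRef a ;; Push 0 false ;; Push 0 false
  | TOr a b => EmitRef b ;; EmitRef a ;; Push 0 true ;; Push 0 false
  | TNot a => EmitRef a ;; Push 0 false ;; Push 0 true
  end.

Lemma run_emit_gate a n m j i s p w t x f g o v tl : n <= K -> m <= K -> j <= K ->
  run N (EmitGate a) (regs i s p (nseq n true) (nseq m true) (nseq j true) w t x f g o v tl) =
  regs (enc_gate (tgate_val n m j a) ++ i) s p (nseq n true) (nseq m true) (nseq j true) w t x f g o v tl.
Proof.
move=> hn hm hj; case: a => [a b|a b|a] /=.
- by step run_emit_ref; step run_emit_ref; rewrite -catA.
- by step run_emit_ref; step run_emit_ref; rewrite -catA.
- by step run_emit_ref.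
Qed.

(** The counter in register 5 runs down from n - 1 to 0, which compensates for prepending: the
    pieces end up in increasing order. *)
Definition EmitAll c := App 3 14 5 ;; Foreach 5 c c.

Lemma run_emit_all c e n i s p m w t x f g o v tl : n <= K ->
  (forall j i, j < n ->
    run N c (regs i s p (nseq n true) m (nseq j true) w t x f g o v tl) =
    regs (e j ++ i) s p (nseq n true) m (nseq j true) w t x f g o v tl) ->
  run N (EmitAll c) (regs i s p (nseq n true) m [::] w t x f g o v tl) =
  regs (flatten (map e (iota 0 n)) ++ i) s p (nseq n true) m [::] w t x f g o v tl.
Proof.
move=> hn hc; rewrite /EmitAll; step run_app; first by rewrite size_nseq.
rewrite cats0; pose gs := rev (iota 0 n).
pose mk (gs : seq nat) i := regs i s p (nseq n true) m (map xpredT gs) w t x f g o v tl.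
transitivity (run N (Foreach 5 c c) (mk gs i)).
  by rewrite /mk -nseq_map size_rev size_iota.
rewrite (@run_foreach _ _ xpredT mk (fun gs _ => size gs <= n /\ gs = rev (iota 0 (size gs)))
  (fun i j => e j ++ i)) //; first 1 last.
- move=> j gs' i' [h1]; rewrite -[size (_ :: _)]addn1 iotaD rev_cat => -[e1 e2].
  split; first by split; [apply: ltnW | exact: e2].
  have {}e1 : j = size gs' by [].
  rewrite -nseq_map {2}/mk -nseq_map -e1; apply: hc.
  by rewrite e1.
- by rewrite size_rev size_iota.
- by rewrite size_rev size_iota.
rewrite /mk /= foldl_rev; congr (regs _ _ _ _ _ _ _ _ _ _ _ _ _ _).
by elim: (iota 0 n) => //= k l ->; rewrite catA.
Qed.

(** * Hardness: the two maps as programs *)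

Definition HardF :=
  App 0 14 1 ;; Clear 0 ;; Parse ;; EmitAll (EmitRef (0, 0, false)) ;; App 11 14 0 ;;
  Push 0 false ;; App 3 14 0 ;; App 3 14 0 ;; App 10 14 0 ;; Push 0 false ;; App 4 14 0 ;;
  Push 0 false ;; App 3 14 0.

(** The wire [n + m], one past the last, does not exist and reads false, so the second half is 0^n
    without any new gate. *)
Definition hard_circuit C :=
  Circuit (c_in C) (c_gates C)
    (c_outs C ++ nseq (c_in C) (c_in C + size (c_gates C))).

Lemma run_hardF C : size (c_outs C) = c_in C -> size (enc_circuit C) <= N ->
  get (run N HardF (regs (enc_circuit C) [::] [::] [::] [::] [::] [::] [::] [::] [::] [::] [::] [::] [::])) 0 =
  enc_circuit (hard_circuit C).
Proof.
move=> ho hN; have NK := leqNK; have hN' := hN; rewrite size_enc_circuit in hN'.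
have [tl ->] : exists tl, run N HardF (regs (enc_circuit C) [::] [::] [::] [::] [::] [::] [::] [::] [::] [::] [::] [::] [::]) = enc_circuit (hard_circuit C) :: tl; last by [].
rewrite /HardF; eexists.
go run_app.
rewrite cats0; go run_clear.
rewrite -[enc_circuit C]cats0.
step run_parse.
eapply run_seqE.
  apply: (@run_emit_all _ (fun j => enc_nat (wref_val (c_in C) (size (c_gates C)) j (0, 0, false)))).
    by lia.
  by move=> j i hj; apply: run_emit_ref; lia.
simst; go run_app.
step run_push.
go run_app.
rewrite cat_false_enc_nat; go run_app.
rewrite cat_enc_nat; go run_app.
step run_push; go run_app.
rewrite cat_false_enc_nat; step run_push.
gofin run_app.
rewrite cat_false_enc_nat; congr cons.
rewrite /enc_circuit /= !cats0 size_cat size_nseq ho map_cat flatten_cat.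
congr (_ ++ (_ ++ (_ ++ (_ ++ (_ ++ flatten _))))).
rewrite map_nseq /wref_val /= mul0n !addn0.
have h (T : Type) (y : T) k b : map (fun=> y) (iota b k) = nseq k y.
  by elim: k b => //= k IH b; rewrite IH.
exact: h.
Qed.

(** The two encodings of solutions differ only in their tags. [Parse] serves to skip the instance;
    the values that it computes are ignored. *)
Definition HardG :=
  App 0 14 1 ;; Clear 0 ;; Parse ;;
  Case 1 Nop (Case 1 Nop (Push 1 false) (Push 1 true)) (Case 1 Nop (Push 1 true) (Push 1 true)) ;;
  App 1 14 0.

Definition hard_sol (s : ekr_sol) : coll_sol :=
  match s with EInvalid i => CZero i | ERepeat i j | EDisjoint i j => CColl i j end.

Lemma run_hardG C s : size (enc_circuit C ++ enc_ekr_sol s) <= N ->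
  get (run N HardG (regs (enc_circuit C ++ enc_ekr_sol s) [::] [::] [::] [::] [::] [::] [::] [::] [::] [::] [::] [::] [::])) 0 =
  enc_coll_sol (hard_sol s).
Proof.
move=> hN; have NK := leqNK; have hN' := hN; rewrite size_cat in hN'.
have hS : size (enc_coll_sol (hard_sol s)) <= K.
  apply: leq_trans NK; apply: leq_trans _ hN'.
  by apply: leq_trans (leq_addl _ _); case: (s) => *; apply: leqnSn.
set rest := enc_ekr_sol s in hN hN' *.
have pre c : run N (App 0 14 1 ;; Clear 0 ;; Parse ;; c)
   (regs (enc_circuit C ++ rest) [::] [::] [::] [::] [::] [::] [::] [::] [::] [::] [::] [::] [::]) =
   run N c (regs [::] rest [::] (nseq (c_in C) true) (nseq (size (c_gates C)) true) [::] (wires C [::])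
    [::] [::] [::] (flatten (map enc_gate (c_gates C))) (flatten (map enc_nat (c_outs C)))
    (rev (eval_circuit C [::])) [::]).
  go run_app; rewrite cats0; go run_clear.
  by go run_parse.
rewrite /HardG pre /rest.
by case: s hS @rest pre hN hN' => [a|a b|a b] hS rest _ _ _; rewrite run_seq run_case; simst; rewrite run_case; simst;
  rewrite run_push; simst; rewrite run_app //=; rewrite ?cats0.
Qed.

(** * Equality tests and branching *)

Definition Neq := Pop 9 ;; Push 9 false.
Definition TestEq r1 r2 :=
  App r1 14 13 ;; App r2 14 15 ;; Push 9 true ;;
  Foreach 13 (Case 15 Neq Nop Neq) (Case 15 Neq Neq Nop) ;;
  Case 15 Nop Neq Neq ;; Clear 15.

Definition testable (st : stacks) r :=
  [&& r < size st, r \notin [:: 9; 13; 14; 15] & size (get st r) <= K].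

Lemma run_testeq i s p n m c w t x f g o v tl r1 r2 :
  let st := regs i s p n m c w t x f g o v tl in
  testable st r1 -> testable st r2 ->
  run N (TestEq r1 r2) st =
  regs i s p n m c w t x ((get st r1 == get st r2) :: f) g o v tl.
Proof.
move=> st /and3P[h1 m1 k1] /and3P[h2 m2 k2]; rewrite /TestEq.
rewrite !inE !negb_or in m1 m2; case/and4P: m1 => a1 b1 c1 d1; case/and4P: m2 => a2 b2 c2 d2.
have [x1 e1] : exists x, get st r1 = x by exists (get st r1).
rewrite e1 in k1 *.
have [x2 e2] : exists x, get st r2 = x by exists (get st r2).
rewrite e2 in k2 *.
eapply run_seqE; first by apply: run_app; rewrite ?e1 //; rewrite cons_uniq !inE negb_or c1 b1.
rewrite e1; eapply run_seqE.
  apply: run_app; rewrite ?size_set ?get_set ?(negPf b2) ?e2 //.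
  by rewrite cons_uniq !inE negb_or c2 d2.
rewrite !get_set /= (negPf b2) e2 /st; simst; rewrite !cats0.
step run_push.
pose mk l (a : bool * seq bool) := [:: i, s, p, n, m, c, w, t, x, a.1 :: f, g, o, v, l, [::], a.2 & tl].
pose h (a : bool * seq bool) b :=
  if a.2 is b' :: y then (if b == b' then a.1 else false, y) else (false, [::]).
eapply run_seqE.
  apply: (@run_foreach _ _ id mk (fun _ _ => True) h _ _ _ x1 (true, x2)) => //.
  - by move=> l a; rewrite map_id.
  - by move=> b l [[] [|b' y]] _; split=> //; rewrite map_id; case: b => //; case: b'.
have -> : foldl h (true, x2) x1 = (x1 == take (size x1) x2, drop (size x1) x2).
  suff H e y : foldl h (e, y) x1 = (e && (x1 == take (size x1) y), drop (size x1) y) by rewrite H.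
  elim: x1 e y {e1 k1} => [|b x1 IH] e y; first by rewrite take0 drop0 eqxx andbT.
  case: y => [|b' y] /=; rewrite /h /= IH ?andbF //.
  by rewrite eqseq_cons; case: eqP => //=; rewrite ?andbF.
have hd : size (drop (size x1) x2) <= K by rewrite size_drop; lia.
have := cat_take_drop (size x1) x2.
case E : (drop _ _) hd => [|b y] hd ed; rewrite run_seq run_case /=; simst.
- by fin run_clear; move: ed; rewrite cats0 => ->.
- have -> : (x1 == x2) = false.
    apply/negP => /eqP e; move: (congr1 size ed); rewrite -e take_size size_cat /=; lia.
  move: hd; clear E ed; case: b => hd; case: (x1 == take _ _);
    by fin run_clear; try exact: ltnW hd.
Qed.

Inductive bexp := BEq of nat & nat | BAnd of bexp & bexp | BNot of bexp.

Fixpoint bval (st : stacks) e :=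
  match e with
  | BEq r1 r2 => get st r1 == get st r2
  | BAnd a b => bval st a && bval st b
  | BNot a => ~~ bval st a
  end.

Fixpoint btestable (st : stacks) e :=
  match e with
  | BEq r1 r2 => testable st r1 && testable st r2
  | BAnd a b => btestable st a && btestable st b
  | BNot a => btestable st a
  end.

Fixpoint Test e :=
  match e with
  | BEq r1 r2 => TestEq r1 r2
  | BAnd a b => Test a ;; Test b ;; AndF
  | BNot a => Test a ;; NotF
  end.

Lemma testable_flag i s p n m c w t x f f' g o v tl r :
  testable (regs i s p n m c w t x f g o v tl) r ->
  testable (regs i s p n m c w t x f' g o v tl) r /\
  get (regs i s p n m c w t x f' g o v tl) r = get (regs i s p n m c w t x f g o v tl) r.
Proof. by rewrite /testable; do 16?case: r => [|r] //. Qed.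

Lemma btestable_flag i s p n m c w t x f f' g o v tl e :
  btestable (regs i s p n m c w t x f g o v tl) e ->
  btestable (regs i s p n m c w t x f' g o v tl) e /\
  bval (regs i s p n m c w t x f' g o v tl) e = bval (regs i s p n m c w t x f g o v tl) e.
Proof.
elim: e => /= [r1 r2 /andP[h1 h2]|a IHa b IHb /andP[/IHa[-> ->] /IHb[-> ->]]|a IHa /IHa[-> ->]] //.
by have [-> ->] := testable_flag f' h1; have [-> ->] := testable_flag f' h2.
Qed.

Lemma run_test i s p n m c w t x f g o v tl e :
  let st := regs i s p n m c w t x f g o v tl in
  btestable st e -> run N (Test e) st = regs i s p n m c w t x (bval st e :: f) g o v tl.
Proof.
elim: e f => [r1 r2|a IHa b IHb|a IHa] f /=.
- by case/andP=> h1 h2; apply: run_testeq.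
- case/andP=> h1 h2; apply: (run_seqE (IHa _ h1)).
  have [h2' e2] := btestable_flag (bval (regs i s p n m c w t x f g o v tl) a :: f) h2.
  apply: (run_seqE (IHb _ h2')); rewrite e2.
  by case: (bval _ a); case: (bval _ b).
- move=> h; apply: (run_seqE (IHa _ h)); by case: (bval _ a).
Qed.

Definition If e c1 c2 := Test e ;; Case 9 Nop c2 c1.

Lemma run_if i s p n m c w t x f g o v tl e c1 c2 :
  let st := regs i s p n m c w t x f g o v tl in
  btestable st e -> run N (If e c1 c2) st = run N (if bval st e then c1 else c2) st.
Proof.
by move=> st h; rewrite /If run_seq run_test // run_case /=; case: (bval _ _).
Qed.

(** * Evaluating the instance at a chosen index *)

Definition Split b := Case 12 Nop (Push b false) (Push b true).
(** Register 12 holds the output reversed: its first n bits are the second half backwards, so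
    popping them onto [b] restores their order, and reversing what remains gives the first half. The
    stacks cleared at the start are leftovers of an earlier probe; register 0 keeps the instance for
    the next one. *)
Definition Probe a b :=
  Clear 1 ;; Clear 3 ;; Clear 4 ;; Clear 6 ;; Clear 10 ;; Clear 11 ;; App 0 14 1 ;; Parse ;;
  App 3 14 5 ;; Foreach 5 (Split b) (Split b) ;; Move 12 a.

Definition bounded (l : seq (seq bool)) := all (fun x => size x <= K) l.

Lemma run_probe C rest a b s p n m w g o tl :
  size (enc_circuit C ++ rest) <= N -> bounded [:: s; p; n; m; w; g; o] ->
  size (c_outs C) = 2 * c_in C ->
  a != b -> a < size tl -> b < size tl -> get tl a = [::] -> get tl b = [::] ->
  run N (Probe (16 + a) (16 + b))
    (regs (enc_circuit C ++ rest) s p n m [::] w [::] [::] [::] g o [::] tl) =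
  regs (enc_circuit C ++ rest) rest [::] (nseq (c_in C) true) (nseq (size (c_gates C)) true)
    [::] (wires C p) [::] [::] [::]
    (flatten (map enc_gate (c_gates C))) (flatten (map enc_nat (c_outs C))) [::]
    (set (set tl b (ekr_snd C p)) a (ekr_fst C p)).
Proof.
move=> hN /and5P[hs hp hn hm /and4P[hw hg ho _]] hout ab ha hb ea eb; have NK := leqNK.
have hN' := hN; rewrite size_cat in hN'; have hN2 := size_enc_circuit C.
rewrite /Probe; do 6 go run_clear.
go run_app; rewrite cats0; go run_parse.
go run_app; rewrite cats0.
set V := rev (eval_circuit C p).
pose mk (l : seq bool) (z : seq bool * seq bool) :=
  regs (enc_circuit C ++ rest) rest [::] (nseq (c_in C) true) (nseq (size (c_gates C)) true)
    l (wires C p) [::] [::] [::]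
    (flatten (map enc_gate (c_gates C))) (flatten (map enc_nat (c_outs C))) z.1
    (set tl b z.2).
pose h (z : seq bool * seq bool) (_ : bool) := if z.1 is y :: v then (v, y :: z.2) else z.
have e0 : tl = set tl b [::] by rewrite -{1}eb set_get.
rewrite [in LHS]e0.
eapply run_seqE.
  apply: (@run_foreach _ _ id mk (fun _ _ => True) h _ _ _ (nseq (c_in C) true) (V, [::])) => //.
  - by move=> l z; rewrite map_id.
  - move=> y l [[|y' v'] z] _; split=> //; rewrite map_id if_same // {1}/mk; simst.
    rewrite run_case; simst.
    by case: y'; rewrite run_push; simst; rewrite -/(set _ _ _) -/(get _ _) get_set eqxx set_set.
  - by rewrite size_nseq; lia.
have szV : size (eval_circuit C p) = 2 * c_in C by rewrite size_map.
have -> : foldl h (V, [::]) (nseq (c_in C) true) = (rev (ekr_fst C p), ekr_snd C p).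
  have H k u z : k <= size u -> foldl h (u, z) (nseq k true) = (drop k u, catrev (take k u) z).
    elim: k u z => [|k IH] u z hk; first by rewrite drop0 take0.
    by case: u hk => //= y u hk; rewrite IH.
  rewrite H ?size_rev ?szV; last by lia.
  rewrite drop_rev take_rev szV -[catrev _ _]/(rev _) revK (_ : 2 * c_in C - c_in C = c_in C) //; lia.
have hf : size (rev (ekr_fst C p)) <= K by rewrite size_rev /ekr_fst size_take szV; case: ifP; lia.
fin run_move.
- by rewrite /mk /= size_set.
- rewrite /mk; simst; rewrite -!/(set _ _ _) -/(get _ _) get_set (negPf ab) ea catrevE cats0 revK.
  by [].
Qed.

(* A non-existing output wire reads false; a gate computed later may be given its index,
   so it is moved beyond all the gates [xgate]. *)
Definition clamp n m o := if o < n + m then o else n + m + 2 * n.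
Definition xgate n m (ob : nat * bool) :=
  if ob.2 then GNot (clamp n m ob.1) else GOr (clamp n m ob.1) (clamp n m ob.1).

(** The common element of the sets of index 0 and index 1, provided that these sets meet; the short
    inputs [[::]] and [[:: true]] are padded by the evaluation. *)
Definition center C :=
  if (ekr_fst C [::] == ekr_fst C [:: true]) || (ekr_fst C [::] == ekr_snd C [:: true])
  then ekr_fst C [::] else ekr_snd C [::].

(** With [T = n + m], the blocks of new wires start at [T] (the 2n xors), [T + 2n] and [T + 3n + 1]
    (the accumulators, n + 1 wires each), [T + 4n + 2] ([s1] and [s2]), [T + 4n + 4] ([e]) and
    [T + 5n + 4] ([q], the outputs). *)
Definition out_ref : wref := (4, 5, true).
(** This gate refers to its own wire, which does not exist yet: it is the constant false from which
    the accumulation starts. The same holds for [gate_z2]. *)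
Definition gate_z1 := TAnd (0, 2, false) (0, 2, false).
Definition gate_c := TOr (0, 0, true) (0, 2, true).
Definition gate_z2 := TAnd (1, 3, false) (1, 3, false).
Definition gate_d := TOr (0, 1, true) (1, 3, true).
Definition gate_s1 := TAnd (0, 3, false) (1, 4, false).
Definition gate_s2 := TNot (2, 4, false).
Definition gate_e := TOr (0, 0, true) (0, 1, true).
Definition gate_q := TAnd (4, 4, true) (3, 4, false).

(* Let [x] be the two halves of the output of [C], each xored with the centre [v].
   Gates [c] and [d] accumulate whether the first, resp. second, half is nonzero;
   [s2] says that one of them is zero, and the output is then the other half. *)
Definition in_circuit C :=
  let n := c_in C in let m := size (c_gates C) in
  let all g := map (fun j => tgate_val n m j g) (iota 0 n) in
  let one g := tgate_val n m 0 g in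
  Circuit n
    (c_gates C ++ map (xgate n m) (zip (c_outs C) (center C ++ center C)) ++
     one gate_z1 :: all gate_c ++ one gate_z2 :: all gate_d ++
     one gate_s1 :: one gate_s2 :: all gate_e ++ all gate_q)
    (map (fun j => wref_val n m j out_ref) (iota 0 n)).

Definition EmitX := App 21 14 23 ;; Push 23 false.
(** Register 20 holds the bits of [v ++ v], 22 the index replacing missing wires, 21 the index after
    clamping. The output references are read in forward order, so the code of the gates is collected
    reversed in register 23. Of the wires in register 6 only their number matters. *)
Definition XGate :=
  RdNat ;; App 6 14 13 ;; App 8 14 21 ;; Foreach 8 (Pop 13) (Pop 13) ;;
  Case 13 (Clear 21 ;; App 22 14 21) Nop Nop ;; Clear 13 ;;
  Case 20 Nop (Push 23 false ;; Push 23 true ;; EmitX ;; EmitX)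
              (Push 23 true ;; Push 23 false ;; EmitX) ;;
  Clear 21.

Lemma run_emitx k i s p n m c w t x f g o v a b a' b' l z xg : k <= K ->
  run N EmitX (regs i s p n m c w t x f g o v [:: a; b; a'; b'; l; nseq k true; z; xg]) =
  regs i s p n m c w t x f g o v [:: a; b; a'; b'; l; nseq k true; z; catrev (enc_nat k) xg].
Proof.
move=> hk; rewrite /EmitX; go run_app; rewrite run_push; simst.
by rewrite /enc_nat catrevE rev_rcons rev_nseq.
Qed.

Lemma run_xgate n m k e i rest p n' m' c w t g o a b a' b' l xg :
  size w = n + m -> k < K -> n + m + 2 * n <= K ->
  run N XGate (regs i (enc_nat k ++ rest) p n' m' c w t [::] [::] g o [::]
    [:: a; b; a'; b'; e :: l; [::]; nseq (n + m + 2 * n) true; xg]) =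
  regs i rest p n' m' c w (catrev (enc_nat k) t) [::] [::] g o [::]
    [:: a; b; a'; b'; l; [::]; nseq (n + m + 2 * n) true; catrev (enc_gate (xgate n m (k, e))) xg].
Proof.
move=> hw hk hz; rewrite /XGate.
step run_rdnat; rewrite cats0; go run_app; rewrite cats0; go run_app; rewrite cats0.
go run_pops; rewrite size_nseq.
have hd : size (drop k w) <= K by rewrite size_drop; lia.
have hc : clamp n m k <= K by rewrite /clamp; case: ifP; lia.
eapply (@run_seqE _ _ _ [:: i, rest, p, n', m', c, w, catrev (enc_nat k) t, [::], [::], g, o, [::],
  behead (drop k w), [::], [::] & [:: a; b; a'; b'; e :: l; nseq (clamp n m k) true; nseq (n + m + 2 * n) true; xg]]).
  rewrite run_case; simst; rewrite /clamp -hw; case: ltnP => h.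
    by rewrite (drop_nth false) //=; case: (nth _ _ _).
  rewrite drop_oversize //=; go run_clear; gofin run_app; rewrite cats0 hw; by [].
go run_clear; first by rewrite size_behead; lia.
rewrite run_seq run_case; simst; case: e; rewrite /xgate /= -run_seq.
- eapply run_seqE; first by step run_push; step run_push; fin run_emitx.
  by gofin run_clear.
- eapply run_seqE; first by step run_push; step run_push; step run_emitx; fin run_emitx.
  by gofin run_clear; rewrite !catrevE rev_cat -!catA.
Qed.

Lemma run_xgates gs n m i p n' m' w t g o a b a' b' xg :
  size w = n + m -> all (fun ob : nat * bool => ob.1 < K) gs -> n + m + 2 * n <= K ->
  size gs <= K ->
  run N (Foreach 5 XGate XGate)
    (regs i (flatten (map enc_nat (map fst gs))) p n' m' (nseq (size gs) true) w t [::] [::] g o [::]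
    [:: a; b; a'; b'; map snd gs; [::]; nseq (n + m + 2 * n) true; xg]) =
  regs i [::] p n' m' [::] w (catrev (flatten (map enc_nat (map fst gs))) t) [::] [::] g o [::]
    [:: a; b; a'; b'; [::]; [::]; nseq (n + m + 2 * n) true;
      catrev (flatten (map enc_gate (map (xgate n m) gs))) xg].
Proof.
move=> hw hb hz hs; rewrite nseq_map.
pose mk (gs : seq (nat * bool)) (z : seq bool * seq bool) :=
  regs i (flatten (map enc_nat (map fst gs))) p n' m' (map xpredT gs) w z.1 [::] [::] g o [::]
    [:: a; b; a'; b'; map snd gs; [::]; nseq (n + m + 2 * n) true; z.2].
pose h (z : seq bool * seq bool) (ob : nat * bool) :=
  (catrev (enc_nat ob.1) z.1, catrev (enc_gate (xgate n m ob)) z.2).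
transitivity (mk [::] (foldl h (t, xg) gs)).
  apply: (@run_foreach _ _ xpredT mk (fun gs _ => all (fun ob : nat * bool => ob.1 < K) gs) h _ _ _ gs (t, xg)) => //.
  by move=> [k e] gs' [t' x'] /= /andP[h1 h2]; split=> //; apply: run_xgate.
have -> : foldl h (t, xg) gs = (catrev (flatten (map enc_nat (map fst gs))) t,
   catrev (flatten (map enc_gate (map (xgate n m) gs))) xg).
  elim: gs t xg {hb hs} => //= ob gs IH t xg; rewrite {2}/h IH /=.
  by rewrite !catrevE !rev_cat -!catA.
by [].
Qed.

Definition InF :=
  Probe 16 17 ;; Push 2 true ;; Probe 18 19 ;;
  If (BNot (BAnd (BNot (BEq 16 18)) (BNot (BEq 16 19))))
    (App 16 14 20 ;; App 16 14 20) (App 17 14 20 ;; App 17 14 20) ;;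
  App 3 14 22 ;; App 3 14 22 ;; App 3 14 22 ;; App 4 14 22 ;;
  Clear 1 ;; App 11 14 1 ;; App 3 14 5 ;; App 3 14 5 ;; Foreach 5 XGate XGate ;; Clear 7 ;; Clear 0 ;;
  EmitAll (EmitRef out_ref) ;; Push 0 false ;; App 3 14 0 ;;
  EmitAll (EmitGate gate_q) ;; EmitAll (EmitGate gate_e) ;; EmitGate gate_s2 ;; EmitGate gate_s1 ;;
  EmitAll (EmitGate gate_d) ;; EmitGate gate_z2 ;; EmitAll (EmitGate gate_c) ;; EmitGate gate_z1 ;;
  Move 23 0 ;; App 10 14 0 ;;
  EmitRef (4, 5, false) ;; Push 0 false ;; App 3 14 0.

Lemma leq16K : 16 <= N -> N * (16 * N) <= K.
Proof. by move=> h; rewrite mulnCA mulnA leq_mul2r leq_mul2r h !orbT. Qed.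

Lemma size_flatten_leq T (e : T -> seq bool) gs B : all (fun g => size (e g) <= B) gs ->
  size (flatten (map e gs)) <= size gs * B.
Proof.
elim: gs => //= g gs IH /andP[h1 h2]; rewrite size_cat mulSn; apply: leq_add => //; exact: IH.
Qed.

Lemma size_ekr C p : size (c_outs C) = 2 * c_in C ->
  size (ekr_fst C p) = c_in C /\ size (ekr_snd C p) = c_in C.
Proof.
move=> h; have e : size (eval_circuit C p) = 2 * c_in C by rewrite size_map.
by rewrite size_takel ?size_drop e; lia.
Qed.

Lemma size_center C : size (c_outs C) = 2 * c_in C -> size (center C) = c_in C.
Proof. by move=> h; have [h1 h2] := size_ekr [::] h; rewrite /center; case: ifP. Qed.

Lemma run_inF C : 16 <= N -> size (c_outs C) = 2 * c_in C -> size (enc_circuit C) <= N ->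
  get (run N InF (regs (enc_circuit C) [::] [::] [::] [::] [::] [::] [::] [::] [::] [::] [::] [::]
     (nseq 8 [::]))) 0 = enc_circuit (in_circuit C).
Proof.
move=> h16 ho hN; have NK := leqNK; have hN' := hN; rewrite size_enc_circuit in hN'.
have h16K := leq16K h16.
have N2 : 16 * N <= K by apply: leq_trans _ h16K; rewrite leq_pmull; lia.
have ho' : all (fun k => k < N) (c_outs C).
  by apply: sub_all (all_size_flatten enc_nat (c_outs C)) => k; rewrite size_enc_nat; lia.
set n := c_in C; set m := size (c_gates C).
have [f0 s0] := size_ekr [::] ho; have [f1 s1] := size_ekr [:: true] ho.
have hw := size_wires C [::]; have hw1 := size_wires C [:: true].
have cc := size_center ho.
pose gs := zip (c_outs C) (center C ++ center C).
have e1 : map fst gs = c_outs C by apply: unzip1_zip; rewrite size_cat cc ho; lia.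
have e2 : map snd gs = center C ++ center C by apply: unzip2_zip; rewrite size_cat cc ho; lia.
have sgs : size gs = 2 * n by rewrite -(size_map fst) e1.
have hgs : all (fun ob : nat * bool => ob.1 < N) gs by rewrite -e1 all_map in ho'.
(* This is the only traversed stack whose length is quadratic in N; it is where N >= 16 is used. *)
have hx : size (flatten (map enc_gate (map (xgate n m) gs))) <= K.
  have H : all (fun g => size (enc_gate g) <= 16 * N) (map (xgate n m) gs).
    rewrite all_map; apply: sub_all hgs => -[k e] /= hk; rewrite /xgate.
    have hc : clamp n m k <= 3 * N by rewrite /clamp; case: ifP; lia.
    by case: e => /=; rewrite ?size_cat ?size_enc_nat; lia.
  apply: leq_trans (size_flatten_leq H) _; apply: leq_trans _ h16K.
  by rewrite size_map leq_mul2r sgs; lia.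
suff [tl ->] : exists tl, run N InF (regs (enc_circuit C) [::] [::] [::] [::] [::] [::] [::] [::] [::] [::] [::] [::] (nseq 8 [::])) = enc_circuit (in_circuit C) :: tl by [].
rewrite /InF -[enc_circuit C]cats0; eexists.
eapply run_seqE; first by apply: (@run_probe _ _ 0 1) => //; rewrite cats0.
simst; step run_push.
eapply run_seqE.
  apply: (@run_probe _ _ 2 3) => //; rewrite ?cats0 //=.
  by rewrite !size_nseq hw; apply/and5P; split; try lia; apply/and4P; split=> //; lia.
simst.
set st := (X in run N _ X).
eapply (@run_seqE _ _ _ (set st 20 (center C ++ center C))).
  rewrite /st run_if; last first.
    by rewrite /= /testable; simst; rewrite f0 f1 s1 /=; lia.
  rewrite (_ : bval _ _ = (ekr_fst C [::] == ekr_fst C [:: true]) || (ekr_fst C [::] == ekr_snd C [:: true])); last first.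
    by rewrite /= negb_and !negbK.
  rewrite /center; case: ifP => _.
    by go run_app; gofin run_app; rewrite !cats0.
  by go run_app; gofin run_app; rewrite !cats0.
rewrite /st {st}; simst.
do 4 go run_app.
rewrite !cats0 -!nseqD (_ : _ + _ = n + m + 2 * n); last by rewrite -/n -/m; lia.
go run_clear; go run_app.
rewrite !cats0 -{1}e1.
do 2 go run_app.
rewrite cats0 -nseqD (_ : _ + _ = size gs) -?e2; last by rewrite sgs; lia.
eapply run_seqE.
  apply: run_xgates; rewrite ?hw1 //; try lia.
  by apply: sub_all hgs => ob; lia.
simst.
go run_clear; first by rewrite catrevE cats0 size_rev e1; lia.
go run_clear.
eapply run_seqE.
  apply: (@run_emit_all _ (fun j => enc_nat (wref_val n m j out_ref))); first by lia.
  by move=> j i hj; apply: run_emit_ref; lia.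
simst; step run_push; go run_app; rewrite cat_false_enc_nat.
eapply run_seqE.
  apply: (@run_emit_all _ (fun j => enc_gate (tgate_val n m j gate_q))); first by lia.
  by move=> j i hj; apply: (@run_emit_gate gate_q); lia.
eapply run_seqE.
  apply: (@run_emit_all _ (fun j => enc_gate (tgate_val n m j gate_e))); first by lia.
  by move=> j i hj; apply: (@run_emit_gate gate_e); lia.
eapply run_seqE; first by apply: (@run_emit_gate gate_s2 n m 0); lia.
eapply run_seqE; first by apply: (@run_emit_gate gate_s1 n m 0); lia.
eapply run_seqE.
  apply: (@run_emit_all _ (fun j => enc_gate (tgate_val n m j gate_d))); first by lia.
  by move=> j i hj; apply: (@run_emit_gate gate_d); lia.
eapply run_seqE; first by apply: (@run_emit_gate gate_z2 n m 0); lia.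
eapply run_seqE.
  apply: (@run_emit_all _ (fun j => enc_gate (tgate_val n m j gate_c))); first by lia.
  by move=> j i hj; apply: (@run_emit_gate gate_c); lia.
eapply run_seqE; first by apply: (@run_emit_gate gate_z1 n m 0); lia.
eapply run_seqE; first by apply: run_move; rewrite // /regs /get /= catrevE cats0 size_rev.
rewrite /regs /get /set [set_nth]lock /= -lock.
eapply run_seqE; first by apply: run_app => //; rewrite /get /=; lia.
eapply run_seqE; first by apply: (@run_emit_ref (4, 5, false) n m 0); lia.
eapply run_seqE; first exact: run_push.
eapply etrans; first by apply: run_app => //; rewrite /= size_nseq; lia.
rewrite /set /get [LHS]/=; congr cons.
rewrite cat_false_enc_nat -[catrev (catrev _ _) _]/(catrev (rev _) _) catrevE revK /enc_circuit.
(* There are n inputs and the last block has n gates, so the number of gates equals the index of the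
   first output wire; this is why [InF] writes it with [EmitRef]. *)
rewrite (_ : size (c_gates (in_circuit C)) = wref_val n m 0 (4, 5, false)); last first.
  rewrite /= -/gs -/n -/m; do 5 rewrite ?(size_cat, size_map, size_iota) /=.
  by rewrite sgs /wref_val -/m /=; lia.
rewrite (_ : size (c_outs (in_circuit C)) = n) ?size_map ?size_iota //.
rewrite /= -/gs -/n -/m; congr (_ ++ (_ ++ _)).
do 6 rewrite ?(map_cat, flatten_cat) /=; rewrite -!map_comp.
do 6 rewrite -?catA /=.
by rewrite cats0.
Qed.

(** * Searching for a solution among six indices *)

Definition raw_index (x y : seq bool) i : seq bool :=
  nth [::] [:: [::]; [:: true]; [:: false; true]; [:: true; true]; x; y] i.

(** Indices are named by position: 0, 1, 2, 3 (low bit first, not padded), then the two strings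
    found. This leaves a fixed finite list of candidates, so the solution map is a decision list of
    fixed length. *)
Inductive desc := DInvalid of nat | DRepeat of nat & nat | DDisjoint of nat & nat.

Definition descs : seq desc :=
  flatten [seq DInvalid i :: flatten [seq [:: DRepeat i j; DDisjoint i j] | j <- iota 0 6] | i <- iota 0 6].

(** Indices are compared after padding, since the strings found may coincide with a fixed index, and
    the fixed ones coincide among themselves when n < 2. *)
Definition holds C x y d : bool :=
  let q i := resize (c_in C) (raw_index x y i) in
  let a i := ekr_fst C (raw_index x y i) in
  let b i := ekr_snd C (raw_index x y i) in
  match d with
  | DInvalid i => a i == b i
  | DRepeat i j => (q i != q j) &&
      (((a i == a j) && (b i == b j)) || ((a i == b j) && (b i == a j)))
  | DDisjoint i j => [&& a i != a j, a i != b j, b i != a j & b i != b j]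
  end.

Definition desc_sol C x y d : ekr_sol :=
  let q i := resize (c_in C) (raw_index x y i) in
  match d with
  | DInvalid i => EInvalid (q i)
  | DRepeat i j => ERepeat (q i) (q j)
  | DDisjoint i j => EDisjoint (q i) (q j)
  end.

Definition in_sol C x y := desc_sol C x y (head (DInvalid 0) (filter (holds C x y) descs)).

Definition coll_fst s := match s with CZero x | CColl x _ => x end.
Definition coll_snd s := match s with CZero _ => [::] | CColl _ y => y end.

Definition RdBitsBody := Case 15 Nop Nop (Case 1 Nop Nop
  (Case 1 Nop (Push 13 false ;; Push 15 true) (Push 13 true ;; Push 15 true))).
Definition RdBits := Push 15 true ;; Loop RdBitsBody.

Lemma run_rdbits y i rest p n m c w t x f g o v tl : size y < K ->
  run N RdBits (regs i (enc_bits y ++ rest) p n m c w t x f g o v tl) =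
  [:: i, rest, p, n, m, c, w, t, x, f, g, o, v, rev y, [::], [::] & tl].
Proof.
move=> hk; rewrite /RdBits run_seq run_loop; apply: (iter_stable _ _ hk) => //.
suff H z : iter (size y).+1 (run N RdBitsBody)
    [:: i, enc_bits y ++ rest, p, n, m, c, w, t, x, f, g, o, v, z, [::], [:: true] & tl] =
    [:: i, rest, p, n, m, c, w, t, x, f, g, o, v, catrev y z, [::], [::] & tl] by exact: (H [::]).
elim: y z {hk} => [|b y IH] z //.
by rewrite [size _]/= iterSr [catrev _ _]/= -IH; case: b.
Qed.

Definition EmitBits q :=
  App q 14 13 ;; Move 13 15 ;; Push 0 false ;;
  Foreach 15 (Push 0 false ;; Push 0 true) (Push 0 true ;; Push 0 true).

Lemma run_emit_bits q i s p n m c w t x f g o v tl : q < size tl -> size (get tl q) <= K ->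
  run N (EmitBits (16 + q)) (regs i s p n m c w t x f g o v tl) =
  regs (enc_bits (get tl q) ++ i) s p n m c w t x f g o v tl.
Proof.
move=> hq hs; rewrite /EmitBits; step run_app; rewrite cats0 -/(get tl q).
step run_move; step run_push.
rewrite -[catrev _ _]/(rev _).
pose mk l i := [:: i, s, p, n, m, c, w, t, x, f, g, o, v, [::], [::], l & tl].
transitivity (mk [::] (foldl (fun i b => [:: true, b & i]) (false :: i) (rev (get tl q)))).
  apply: (@run_foreach _ _ id mk (fun _ _ => True)) => //; last by rewrite size_rev.
  - by move=> l a; rewrite map_id.
  - by move=> b l a _; rewrite map_id; case: b.
rewrite foldl_rev /mk /regs; congr cons.
by rewrite /enc_bits -catA /get; elim: (nth [::] tl q) => //= b l ->.
Qed.

(** Three registers for each of the six indices: the padded index and the two halves of its value.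
    They end at 33; registers 34 and 35 keep the strings found. *)
Definition regQ i := 16 + 3 * i.
Definition regA i := 16 + (3 * i).+1.
Definition regB i := 16 + (3 * i).+2.
Definition BOr a b := BNot (BAnd (BNot a) (BNot b)).
Definition desc_test d :=
  match d with
  | DInvalid i => BEq (regA i) (regB i)
  | DRepeat i j => BAnd (BNot (BEq (regQ i) (regQ j)))
      (BOr (BAnd (BEq (regA i) (regA j)) (BEq (regB i) (regB j)))
           (BAnd (BEq (regA i) (regB j)) (BEq (regB i) (regA j))))
  | DDisjoint i j => BAnd (BNot (BEq (regA i) (regA j))) (BAnd (BNot (BEq (regA i) (regB j)))
      (BAnd (BNot (BEq (regB i) (regA j))) (BNot (BEq (regB i) (regB j)))))
  end.
Definition desc_out d :=
  match d with
  | DInvalid i => EmitBits (regQ i) ;; Push 0 false ;; Push 0 false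
  | DRepeat i j => EmitBits (regQ j) ;; EmitBits (regQ i) ;; Push 0 true ;; Push 0 false
  | DDisjoint i j => EmitBits (regQ j) ;; EmitBits (regQ i) ;; Push 0 false ;; Push 0 true
  end.
Definition Select ds :=
  foldr (fun d c => If (desc_test d) (desc_out d) c) (desc_out (DInvalid 0)) ds.

Definition PushIndex i :=
  match i with
  | 0 => Nop | 1 => Push 2 true | 2 => Push 2 true ;; Push 2 false
  | 3 => Push 2 true ;; Push 2 true | 4 => App 34 14 2 | _ => App 35 14 2
  end.
(** The index is written twice because [Probe] consumes it. *)
Definition Cand i :=
  PushIndex i ;; Probe (regA i) (regB i) ;; PushIndex i ;; Resize ;; Move 13 (regQ i).

Definition InG :=
  Probe (regA 0) (regB 0) ;;
  Case 1 Nop (RdBits ;; Move 13 34) (RdBits ;; Move 13 34 ;; RdBits ;; Move 13 35) ;;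
  Resize ;; Move 13 (regQ 0) ;;
  Cand 1 ;; Cand 2 ;; Cand 3 ;; Cand 4 ;; Cand 5 ;; Clear 0 ;; Select descs.

Definition cand_slots C x y i :=
  [:: resize (c_in C) (raw_index x y i); ekr_fst C (raw_index x y i); ekr_snd C (raw_index x y i)].

Lemma run_push_index x y i I s n m w g o tl : i < 6 -> size x <= K -> size y <= K ->
  size tl = 20 -> get tl 18 = x -> get tl 19 = y ->
  run N (PushIndex i) (regs I s [::] n m [::] w [::] [::] [::] g o [::] tl) =
  regs I s (raw_index x y i) n m [::] w [::] [::] [::] g o [::] tl.
Proof.
move=> hi hx hy ht ex ey; subst x y.
case: i hi => [|[|[|[|[|[|//]]]]]] _ //=.
- by fin run_app; rewrite ?cats0 /= ?ht.
- by fin run_app; rewrite ?cats0 /= ?ht.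
Qed.

Lemma get_slots (u v : stacks) (a b c : seq bool) i j : size u = 3 * i -> j < 3 ->
  get (u ++ [:: a, b, c & v]) (3 * i + j) = get [:: a; b; c] j.
Proof.
move=> hu hj; rewrite /get nth_cat hu ltnNge leq_addr /= addKn.
by case: j hj => [|[|[|]]].
Qed.

Lemma run_cand C x y i rest (u v : stacks) s w :
  size (enc_circuit C ++ rest) <= N -> size (c_outs C) = 2 * c_in C ->
  i < 6 -> size x <= K -> size y <= K -> size s <= K -> size w <= K ->
  size u = 3 * i -> size v = 17 - 3 * i ->
  get v (15 - 3 * i) = x -> get v (16 - 3 * i) = y ->
  let st s w sl := regs (enc_circuit C ++ rest) s [::] (nseq (c_in C) true)
    (nseq (size (c_gates C)) true) [::] w [::] [::] [::]
    (flatten (map enc_gate (c_gates C))) (flatten (map enc_nat (c_outs C))) [::]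
    (u ++ sl ++ v) in
  run N (Cand i) (st s w [:: [::]; [::]; [::]]) =
  st rest (wires C (raw_index x y i)) (cand_slots C x y i).
Proof.
move=> hN ho hi hx hy hs hw hu hv ex ey st.
have NK := leqNK; have hN' := hN; rewrite size_cat size_enc_circuit in hN'.
have hr : size (raw_index x y i) <= K by case: i hi {hu hv ex ey} => [|[|[|[|[|[|]]]]]] //= _; lia.
have gx sl : size sl = 3 -> get (u ++ sl ++ v) 18 = x.
  by move=> h; rewrite /get !nth_cat hu h -ex /get ifF ?ifF; try lia; congr (nth _ _ _); lia.
have gy sl : size sl = 3 -> get (u ++ sl ++ v) 19 = y.
  by move=> h; rewrite /get !nth_cat hu h -ey /get ifF ?ifF; try lia; congr (nth _ _ _); lia.
have sz sl : size sl = 3 -> size (u ++ sl ++ v) = 20 by move=> h; rewrite !size_cat hu h hv; lia.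
rewrite /Cand /st; eapply run_seqE.
  by apply: (@run_push_index x y) => //; rewrite ?sz ?gx ?gy.
eapply run_seqE.
  apply: (@run_probe C rest (3 * i).+1 (3 * i).+2) => //.
  - rewrite /bounded /= hs hw hr !size_nseq; lia.
  - by rewrite neq_ltn ltnSn.
  - by rewrite sz //; lia.
  - by rewrite sz //; lia.
  - by rewrite -addn1 get_slots.
  - by rewrite -addn2 get_slots.
have -> : set (set (u ++ [:: [::]; [::]; [::]] ++ v) (3 * i).+2 (ekr_snd C (raw_index x y i)))
     (3 * i).+1 (ekr_fst C (raw_index x y i)) =
     u ++ [:: [::]; ekr_fst C (raw_index x y i); ekr_snd C (raw_index x y i)] ++ v.
  have E z1 z2 : u ++ [:: [::]; z1; z2] ++ v = rcons u [::] ++ [:: z1, z2 & v] by rewrite cat_rcons.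
  by rewrite !E set_sizeS ?size_rcons ?hu // set_size ?size_rcons ?hu.
eapply run_seqE.
  by apply: (@run_push_index x y) => //; rewrite ?sz ?gx ?gy.
eapply run_seqE; first by apply: run_resize; lia.
set a := ekr_fst _ _; set b := ekr_snd _ _; set Q := resize _ _.
eapply etrans; first apply: run_move => //.
- by rewrite /= size_cat /= hu hv /regQ; lia.
- by rewrite /get /= size_rev size_mkseq; lia.
rewrite -[LHS]/(regs (enc_circuit C ++ rest) rest [::] (nseq (c_in C) true)
    (nseq (size (c_gates C)) true) [::] (wires C (raw_index x y i)) [::] [::] [::]
    (flatten (map enc_gate (c_gates C))) (flatten (map enc_nat (c_outs C))) [::]
    (set (u ++ [:: [::], a, b & v]) (3 * i) (catrev (rev Q) (get (u ++ [:: [::], a, b & v]) (3 * i))))).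
by rewrite get_size // catrevE cats0 revK set_size.
Qed.

Definition desc_ok d :=
  match d with DInvalid i => i < 6 | DRepeat i j | DDisjoint i j => (i < 6) && (j < 6) end.

#[local] Arguments get : simpl never.
#[local] Arguments testable : simpl never.
#[local] Arguments raw_index : simpl never.
#[local] Arguments regA : simpl never.

Lemma run_select C x y s n m w g o tl ds :
  (forall i j, i < 6 -> j < 3 -> get tl (3 * i + j) = get (cand_slots C x y i) j) ->
  size tl = 20 -> size (c_outs C) = 2 * c_in C -> c_in C <= K ->
  all desc_ok ds ->
  get (run N (Select ds) (regs [::] s [::] n m [::] w [::] [::] [::] g o [::] tl)) 0 =
  enc_ekr_sol (desc_sol C x y (head (DInvalid 0) (filter (holds C x y) ds))).
Proof.
move=> ht sz ho hn; set st := regs _ _ _ _ _ _ _ _ _ _ _ _ _ _.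
have gQ i : i < 6 -> get tl (3 * i) = resize (c_in C) (raw_index x y i).
  by move=> hi; have := ht i 0 hi erefl; rewrite addn0.
have gA i : i < 6 -> get tl (3 * i).+1 = ekr_fst C (raw_index x y i).
  by move=> hi; have := ht i 1 hi erefl; rewrite addn1.
have gB i : i < 6 -> get tl (3 * i).+2 = ekr_snd C (raw_index x y i).
  by move=> hi; have := ht i 2 hi erefl; rewrite addn2.
have rQ i : i < 6 -> testable st (regQ i) /\ get st (regQ i) = resize (c_in C) (raw_index x y i).
  move=> hi; have e : get st (regQ i) = get tl (3 * i) by [].
  rewrite /testable e gQ // size_mkseq hn; split=> //; apply/and3P; split=> //.
  by rewrite /= sz /regQ; lia.
have rA i : i < 6 -> testable st (regA i) /\ get st (regA i) = ekr_fst C (raw_index x y i).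
  move=> hi; have e : get st (regA i) = get tl (3 * i).+1 by [].
  have [h _] := size_ekr (raw_index x y i) ho.
  rewrite /testable e gA // h hn; split=> //; apply/and3P; split=> //.
  by rewrite /= sz /regA; lia.
have rB i : i < 6 -> testable st (regB i) /\ get st (regB i) = ekr_snd C (raw_index x y i).
  move=> hi; have e : get st (regB i) = get tl (3 * i).+2 by [].
  have [_ h] := size_ekr (raw_index x y i) ho.
  rewrite /testable e gB // h hn; split=> //; apply/and3P; split=> //.
  by rewrite /= sz /regB; lia.
have emit i0 i : i < 6 -> run N (EmitBits (regQ i)) (regs i0 s [::] n m [::] w [::] [::] [::] g o [::] tl) =
   regs (enc_bits (resize (c_in C) (raw_index x y i)) ++ i0) s [::] n m [::] w [::] [::] [::] g o [::] tl.
  by move=> hi; rewrite /regQ (@run_emit_bits (3 * i)) ?gQ ?size_mkseq // sz; lia.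
have out d : desc_ok d ->
    get (run N (desc_out d) st) 0 = enc_ekr_sol (desc_sol C x y d).
  case: d => [i hi|i j /andP[hi hj]|i j /andP[hi hj]]; rewrite /desc_out /st run_seq emit //.
  - by rewrite cats0.
  - by rewrite run_seq emit // cats0.
  - by rewrite run_seq emit // cats0.
have test d : desc_ok d ->
    btestable st (desc_test d) /\ bval st (desc_test d) = holds C x y d.
  clearbody st; case: d => [i hi|i j /andP[hi hj]|i j /andP[hi hj]] /=.
  - by have [-> ->] := rA i hi; have [-> ->] := rB i hi.
  - have [-> ->] := rA i hi; have [-> ->] := rB i hi; have [-> ->] := rQ i hi.
    have [-> ->] := rA j hj; have [-> ->] := rB j hj; have [-> ->] := rQ j hj.
    by rewrite negb_and !negbK.
  - have [-> ->] := rA i hi; have [-> ->] := rB i hi.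
    by have [-> ->] := rA j hj; have [-> ->] := rB j hj.
elim: ds => [_|d ds IH /= /andP[hd hds]]; first exact: out.
have [t1 t2] := test d hd.
rewrite /Select /= run_if // t2; case: (holds C x y d); first by rewrite out.
exact: IH.
Qed.

Lemma size_enc_bits x : size x <= size (enc_bits x).
Proof. by rewrite /enc_bits size_cat; elim: x => //= b x; lia. Qed.

Lemma run_inG C s : size (c_outs C) = 2 * c_in C -> size (enc_circuit C ++ enc_coll_sol s) <= N ->
  get (run N InG (regs (enc_circuit C ++ enc_coll_sol s) [::] [::] [::] [::] [::] [::] [::] [::] [::] [::] [::] [::]
     (nseq 20 [::]))) 0 = enc_ekr_sol (in_sol C (coll_fst s) (coll_snd s)).
Proof.
move=> ho hN; have NK := leqNK; have hN' := hN; rewrite size_cat size_enc_circuit in hN'.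
set x := coll_fst s; set y := coll_snd s; set rest := enc_coll_sol s in hN hN' *.
have hxy : size x < K /\ size y < K.
  rewrite /x /y; move: hN'; rewrite /rest; case: (s) => [z|z z'] /=; have hz := size_enc_bits z.
    by lia.
  by rewrite size_cat; have hz' := size_enc_bits z'; lia.
case: hxy => hx hy.
pose st s w tl := regs (enc_circuit C ++ rest) s [::] (nseq (c_in C) true)
    (nseq (size (c_gates C)) true) [::] w [::] [::] [::]
    (flatten (map enc_gate (c_gates C))) (flatten (map enc_nat (c_outs C))) [::] tl.
rewrite /InG run_seq (@run_probe C rest 1 2) //.
set tl0 := set _ _ _.
rewrite run_seq -[regs _ _ _ _ _ _ _ _ _ _ _ _ _ _]/(st rest (wires C [::]) [:: [::], ekr_fst C [::], ekr_snd C [::] & nseq 17 [::]]).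
have -> : run N (Case 1 Nop (RdBits ;; Move 13 34) (RdBits ;; Move 13 34 ;; RdBits ;; Move 13 35))
    (st rest (wires C [::]) [:: [::], ekr_fst C [::], ekr_snd C [::] & nseq 17 [::]]) =
    st [::] (wires C [::]) [:: [::], ekr_fst C [::], ekr_snd C [::] & nseq 15 [::] ++ [:: x; y]].
  rewrite run_case /rest /x /y; move: hx hy; rewrite /x /y; case: (s) => [z|z z'] /= hz hz'.
  - rewrite /st -[enc_bits z]cats0; simst; step run_rdbits.
    by fin run_move; rewrite ?size_rev ?(ltnW hz) // catrevE cats0 revK.
  - rewrite /st -[enc_bits z']cats0; simst; step run_rdbits.
    step run_move; first by rewrite size_rev ltnW.
    rewrite catrevE revK (cats0 z); step run_rdbits.
    by fin run_move; rewrite ?size_rev ?(ltnW hz') // catrevE cats0 revK.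
have hw p : size (wires C p) <= K by rewrite size_wires; lia.
have hr : size rest <= K by lia.
rewrite /st run_seq run_resize ?leq0n //; last by lia.
rewrite run_seq run_move //; last by rewrite /get /= size_rev size_mkseq; lia.
rewrite catrevE revK cats0.
pose sl := cand_slots C x y.
rewrite -[set _ _ _]/(st [::] (wires C [::]) (sl 0 ++ [:: [::]; [::]; [::]] ++ nseq 12 [::] ++ [:: x; y])).
have hxk := ltnW hx; have hyk := ltnW hy.
rewrite run_seq (@run_cand C x y 1 rest (sl 0) (nseq 12 [::] ++ [:: x; y]) [::] (wires C [::])) //.
rewrite run_seq -[regs _ _ _ _ _ _ _ _ _ _ _ _ _ _]/(st rest (wires C (raw_index x y 1)) ((sl 0 ++ sl 1) ++ [:: [::]; [::]; [::]] ++ nseq 9 [::] ++ [:: x; y])).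
rewrite (@run_cand C x y 2 rest (sl 0 ++ sl 1) (nseq 9 [::] ++ [:: x; y]) rest) //.
rewrite run_seq -[regs _ _ _ _ _ _ _ _ _ _ _ _ _ _]/(st rest (wires C (raw_index x y 2)) ((sl 0 ++ sl 1 ++ sl 2) ++ [:: [::]; [::]; [::]] ++ nseq 6 [::] ++ [:: x; y])).
rewrite (@run_cand C x y 3 rest (sl 0 ++ sl 1 ++ sl 2) (nseq 6 [::] ++ [:: x; y]) rest) //.
rewrite run_seq -[regs _ _ _ _ _ _ _ _ _ _ _ _ _ _]/(st rest (wires C (raw_index x y 3)) ((sl 0 ++ sl 1 ++ sl 2 ++ sl 3) ++ [:: [::]; [::]; [::]] ++ nseq 3 [::] ++ [:: x; y])).
rewrite (@run_cand C x y 4 rest (sl 0 ++ sl 1 ++ sl 2 ++ sl 3) (nseq 3 [::] ++ [:: x; y]) rest) //.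
rewrite run_seq -[regs _ _ _ _ _ _ _ _ _ _ _ _ _ _]/(st rest (wires C (raw_index x y 4)) ((sl 0 ++ sl 1 ++ sl 2 ++ sl 3 ++ sl 4) ++ [:: [::]; [::]; [::]] ++ [:: x; y])).
rewrite (@run_cand C x y 5 rest (sl 0 ++ sl 1 ++ sl 2 ++ sl 3 ++ sl 4) [:: x; y] rest) //.
rewrite run_seq run_clear //; last by rewrite /get /=; lia.
rewrite -[set _ _ _]/(regs [::] rest [::] (nseq (c_in C) true)
    (nseq (size (c_gates C)) true) [::] (wires C (raw_index x y 5)) [::] [::] [::]
    (flatten (map enc_gate (c_gates C))) (flatten (map enc_nat (c_outs C))) [::]
    (sl 0 ++ sl 1 ++ sl 2 ++ sl 3 ++ sl 4 ++ sl 5 ++ [:: x; y])).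
rewrite (@run_select C x y) //; last by lia.
by move=> i j; case: i => [|[|[|[|[|[|]]]]]] // _; case: j => [|[|[|]]].
Qed.

End Programs.

(** * Correctness of the reductions *)

Lemma eval_circuitE C p : eval_circuit C p = map (nth false (wires C p)) (c_outs C).
Proof. by []. Qed.

Lemma eval_hard C p :
  eval_circuit (hard_circuit C) p = eval_circuit C p ++ nseq (c_in C) false.
Proof.
rewrite !eval_circuitE map_cat map_nseq; congr (_ ++ nseq _ _).
by rewrite nth_default // (size_wires (hard_circuit C)).
Qed.

Lemma hard_sol_valid (C : circuit) (H : size (c_outs C) == c_in C)
    (H' : size (c_outs (hard_circuit C)) == 2 * c_in (hard_circuit C)) s :
  ekr_valid (exist _ (hard_circuit C) H') s -> coll_valid (exist _ C H) (hard_sol s).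
Proof.
have sz p : size (eval_circuit C p) = c_in C by rewrite size_map (eqP H).
have ef p : ekr_fst (hard_circuit C) p = eval_circuit C p.
  by rewrite /ekr_fst eval_hard take_size_cat ?sz.
have es p : ekr_snd (hard_circuit C) p = nseq (c_in C) false.
  by rewrite /ekr_snd eval_hard drop_size_cat ?sz.
case: s => [i|i j|i j] /=; rewrite !ef !es.
- by [].
(* If the sets agree crosswise, both values of C are 0^n, which is again a collision. *)
- by move=> [? [? [? [[-> _]|[-> <-]]]]].
- by move=> [_ [_ [_ [_ [_ /(_ erefl)]]]]].
Qed.

Notation add_gate := (fun w g => rcons w (gate_val w g)).

(** Gate j is given the first j values of its own block, so the lemma also covers accumulators,
    where each gate reads the preceding one. *)
Lemma add_gates_block k (G : nat -> gate) h w :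
  (forall j, j < k -> gate_val (w ++ mkseq h j) (G j) = h j) ->
  foldl add_gate w (map G (iota 0 k)) = w ++ mkseq h k.
Proof.
elim: k => [|k IH] H; first by rewrite cats0.
rewrite -[k.+1]addn1 /mkseq iotaD !map_cat foldl_cat IH /=; last by move=> j /ltnW; apply: H.
by rewrite add0n H // -cats1 -catA.
Qed.

Lemma nth_pre (u v : seq bool) i : i < size u -> nth false (u ++ v) i = nth false u i.
Proof. by move=> h; rewrite nth_cat h. Qed.

Lemma nth_block (u : seq bool) h k i j : i = size u + j -> j < k -> nth false (u ++ mkseq h k) i = h j.
Proof. by move=> -> hj; rewrite nth_cat ltnNge leq_addr /= addKn nth_mkseq. Qed.

Lemma map_iotaS T (f : nat -> T) n : map f (iota 0 n.+1) = f 0 :: map (fun j => f j.+1) (iota 0 n).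
Proof. by rewrite /= -[1]addn0 iotaDl -map_comp. Qed.

Lemma has_iotaS (X : nat -> bool) k : has X (iota 0 k.+1) = X k || has X (iota 0 k).
Proof. by rewrite -addn1 iotaD has_cat /= orbF orbC add0n. Qed.

Lemma eval_in_bits C p : size (c_outs C) = 2 * c_in C ->
  let n := c_in C in
  let X k := nth false (eval_circuit C p) k (+) nth false (center C ++ center C) k in
  eval_circuit (in_circuit C) p =
  mkseq (fun j => (X j || X (n + j)) &&
    ~~ (has X (iota 0 n) && has (fun j => X (n + j)) (iota 0 n))) n.
Proof.
move=> ho n X; set m := size (c_gates C); pose T := n + m.
have cc := size_center ho.
pose Y j := X (n + j).
pose A k := has X (iota 0 k); pose B k := has Y (iota 0 k).
pose w := wires C p; pose w1 := w ++ mkseq X (2 * n); pose w2 := w1 ++ mkseq A n.+1.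
pose w3 := w2 ++ mkseq B n.+1.
pose w4 := w3 ++ [:: A n && B n; ~~ (A n && B n)].
pose E j := X j || Y j; pose w5 := w4 ++ mkseq E n.
pose Q j := E j && ~~ (A n && B n).
have s0 : size w = T by rewrite size_wires.
have s1 : size w1 = T + 2 * n by rewrite size_cat size_mkseq s0.
have s2 : size w2 = T + 3 * n + 1 by rewrite size_cat size_mkseq s1; lia.
have s3 : size w3 = T + 4 * n + 2 by rewrite size_cat size_mkseq s2; lia.
have s4 : size w4 = T + 4 * n + 4 by rewrite size_cat /= s3; lia.
have s5 : size w5 = T + 5 * n + 4 by rewrite size_cat size_mkseq s4; lia.
have x1 j : j < 2 * n -> nth false w1 (T + j) = X j by move=> h; apply: nth_block; rewrite ?s0.
have x4 j u : j < 2 * n -> nth false (w4 ++ u) (T + j) = X j.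
  move=> h; rewrite nth_pre ?s4; last by lia.
  rewrite nth_pre ?s3; last by lia.
  rewrite nth_pre ?s2; last by lia.
  rewrite nth_pre ?s1; [exact: x1 | by lia].
have wf : wires (in_circuit C) p = w5 ++ mkseq Q n.
  rewrite /wires [c_in _]/= [c_gates _]/= -/n -/m foldl_cat -/(wires C p) -/w foldl_cat.
  set gs := zip _ _.
  have sgs : size gs = 2 * n by rewrite size_zip size_cat cc ho; lia.
  have -> : map (xgate n m) gs = map (fun k => xgate n m (nth (0, false) gs k)) (iota 0 (2 * n)).
    by rewrite (map_comp (xgate n m) (nth (0, false) gs)) -sgs map_nth_iota0 // take_size.
  rewrite (@add_gates_block _ _ X) -/w1; last first.
    move=> j hj.
    have -> : nth (0, false) gs j = (nth 0 (c_outs C) j, nth false (center C ++ center C) j).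
      by rewrite nth_zip // size_cat cc ho; lia.
    (* A clamped missing output still reads false here, since fewer than 2n xor gates have been
       added so far. *)
    have cl : nth false (w ++ mkseq X j) (clamp n m (nth 0 (c_outs C) j)) = nth false (eval_circuit C p) j.
      rewrite eval_circuitE (nth_map 0) ?ho // -/w /clamp -/T; case: ltnP => h.
        by rewrite nth_pre ?s0.
      rewrite [RHS]nth_default ?s0 //; apply: nth_default.
      by rewrite size_cat size_mkseq s0; lia.
    by rewrite /xgate /X; case: (nth false (center C ++ center C) j); rewrite /= !cl ?orbb ?addbT ?addbF.
  (* The constant gate and the n accumulating gates are merged into one block of n + 1 gates, whose
     values are the prefix disjunctions [A 0], ..., [A n]. *)
  rewrite -cat_cons -[tgate_val n m 0 gate_z1 :: _](map_iotaS (fun k => if k is k'.+1 then tgate_val n m k' gate_c else tgate_val n m 0 gate_z1)).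
  rewrite foldl_cat (@add_gates_block _ _ A) -/w2; last first.
    move=> [|j] hj.
      rewrite /= nth_default //= cats0 s1 /wref_val /= /T; lia.
    rewrite /= /A has_iotaS; congr orb.
      rewrite nth_pre ?s1; last by rewrite /wref_val /= /T; lia.
      by rewrite -x1; [congr nth; rewrite /wref_val /= /T; lia | lia].
    by apply: nth_block => //; rewrite s1 /wref_val /= /T; lia.
  rewrite -cat_cons -[tgate_val n m 0 gate_z2 :: _](map_iotaS (fun k => if k is k'.+1 then tgate_val n m k' gate_d else tgate_val n m 0 gate_z2)).
  rewrite foldl_cat (@add_gates_block _ _ B) -/w3; last first.
    move=> [|j] hj.
      rewrite /= nth_default //= cats0 s2 /wref_val /= /T; lia.
    rewrite /= /B has_iotaS; congr orb.
      rewrite nth_pre ?s2; last by rewrite /wref_val /= /T; lia.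
      rewrite nth_pre ?s1; last by rewrite /wref_val /= /T; lia.
      by rewrite /Y -x1; [congr nth; rewrite /wref_val /= /T; lia | lia].
    by apply: nth_block => //; rewrite s2 /wref_val /= /T; lia.
  have gA : nth false w3 (wref_val n m 0 (0, 3, false)) = A n.
    rewrite nth_pre ?s2; last by rewrite /wref_val /= /T; lia.
    by apply: nth_block => //; rewrite s1 /wref_val /= /T; lia.
  have gB : nth false w3 (wref_val n m 0 (1, 4, false)) = B n.
    by apply: nth_block => //; rewrite s2 /wref_val /= /T; lia.
  have -> l : foldl add_gate w3 [:: tgate_val n m 0 gate_s1, tgate_val n m 0 gate_s2 & l] = foldl add_gate w4 l.
    rewrite /= gA gB; congr foldl; rewrite nth_rcons s3.
    rewrite (_ : wref_val n m 0 (2, 4, false) = T + 4 * n + 2); last by rewrite /wref_val /= /T; lia.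
    by rewrite ltnn eqxx -!cats1 -catA.
  rewrite foldl_cat (@add_gates_block n _ E w4) -/w5; last first.
    move=> j hj; rewrite -[RHS]/(orb (X j) (Y j)) -[LHS]/(orb (nth _ _ _) (nth _ _ _)); congr orb.
      by rewrite -(x4 j (mkseq E j)); [congr nth; rewrite /wref_val /= /T; lia | lia].
    by rewrite /Y -(x4 (n + j) (mkseq E j)); [congr nth; rewrite /wref_val /= /T; lia | lia].
  apply: add_gates_block => j hj; rewrite -[RHS]/(andb (E j) (~~ (A n && B n))).
  rewrite -[LHS]/(andb (nth _ _ _) (nth _ _ _)); congr andb.
    rewrite nth_pre ?s5; last by rewrite /wref_val /= /T; lia.
    by apply: nth_block => //; rewrite s4 /wref_val /= /T; lia.
  rewrite nth_pre ?s5; last by rewrite /wref_val /= /T; lia.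
  rewrite nth_pre ?s4; last by rewrite /wref_val /= /T; lia.
  rewrite (_ : wref_val n m j (3, 4, false) = size w3 + 1); last by rewrite s3 /wref_val /= /T; lia.
  by rewrite nth_cat ltnNge leq_addr /= addKn.
rewrite eval_circuitE wf /= -/n -/m -map_comp /mkseq; apply/eq_in_map => j.
rewrite mem_iota add0n /= => hj.
by apply: nth_block => //; rewrite s5 /wref_val /= /T; lia.
Qed.

Lemma has_xor n (u v : seq bool) : size u = n -> size v = n ->
  has (fun j => nth false u j (+) nth false v j) (iota 0 n) = (u != v).
Proof.
move=> su sv; apply/idP/idP.
- by case/hasP=> j _ h; apply/eqP => e; move: h; rewrite e addbb.
- apply: contraR => /hasPn h; apply/eqP; apply: (@eq_from_nth _ false); rewrite su ?sv // => j hj.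
  have := h j; rewrite mem_iota add0n leq0n hj => /(_ isT).
  by case: (nth false u j); case: (nth false v j).
Qed.

Definition xors n (u v : seq bool) := mkseq (fun j => nth false u j (+) nth false v j) n.

Lemma xors_inj n u u' v : size u = n -> size u' = n -> xors n u v = xors n u' v -> u = u'.
Proof.
move=> su su' e; apply: (@eq_from_nth _ false); rewrite su ?su' // => j hj.
have := congr1 (fun s => nth false s j) e; rewrite !nth_mkseq //.
by case: (nth false u j); case: (nth false u' j); case: (nth false v j).
Qed.

Lemma xorsvv n v : xors n v v = nseq n false.
Proof. by apply: (@eq_from_nth _ false); rewrite size_mkseq ?size_nseq // => j hj; rewrite nth_mkseq // addbb nth_nseq hj. Qed.

Lemma eval_in C p : size (c_outs C) = 2 * c_in C ->
  let n := c_in C in let a := ekr_fst C p in let b := ekr_snd C p in let v := center C in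
  eval_circuit (in_circuit C) p =
  if a == v then xors n b v else if b == v then xors n a v else nseq n false.
Proof.
move=> ho n a b v; rewrite eval_in_bits // -/n -/v.
have [sa sb] := size_ekr p ho; have sv := size_center ho.
have ev : eval_circuit C p = a ++ b by rewrite cat_take_drop.
have Xa j : j < n -> nth false (eval_circuit C p) j (+) nth false (v ++ v) j = nth false a j (+) nth false v j.
  by move=> hj; rewrite ev !nth_cat sa sv hj.
have Xb j : nth false (eval_circuit C p) (n + j) (+) nth false (v ++ v) (n + j) = nth false b j (+) nth false v j.
  by rewrite ev !nth_cat sa sv ltnNge leq_addr /= addKn.
have -> : has (fun k => nth false (eval_circuit C p) k (+) nth false (v ++ v) k) (iota 0 n) = (a != v).
  rewrite -(has_xor sa sv); apply: eq_in_has => j; rewrite mem_iota add0n /=; exact: Xa.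
have -> : has (fun j => nth false (eval_circuit C p) (n + j) (+) nth false (v ++ v) (n + j)) (iota 0 n) = (b != v).
  by rewrite -(has_xor sb sv); apply: eq_has => j; apply: Xb.
case: eqP => [e|_]; [|case: eqP => [e|_]];
  (apply: (@eq_from_nth _ false); rewrite ?size_mkseq ?size_nseq // => j hj; rewrite !nth_mkseq // Xa // Xb).
- by rewrite e addbb andbT.
- by rewrite e addbb orbF andbT.
- by rewrite andbF nth_nseq hj.
Qed.

(** * Pairwise intersecting families of pairs *)

Section Pairs.
Variable T : eqType.
Definition meets (a b c d : T) := ~~ [&& a != c, a != d, b != c & b != d].
Definition same (a b c d : T) := ((a == c) && (b == d)) || ((a == d) && (b == c)).

Lemma meetsP a b c d : meets a b c d -> a = c \/ a = d \/ b = c \/ b = d.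
Proof.
rewrite /meets; case: (a =P c) => [|_]; first by left.
case: (a =P d) => [|_]; first by right; left.
case: (b =P c) => [|_]; first by right; right; left.
by case: (b =P d) => [|_] //; right; right; right.
Qed.

Lemma sameP a b c d : ~~ same a b c d -> ~ (a = c /\ b = d) /\ ~ (a = d /\ b = c).
Proof.
by rewrite /same negb_or => /andP[h1 h2]; split=> -[e1 e2]; subst; rewrite !eqxx in h1 h2.
Qed.

(** A pair avoiding [v] can meet {v, x} and {v, y} only in x and in y, and these two fill it. *)
Lemma mem_or_third (v x y a b : T) : v <> x -> v <> y -> x <> y -> a <> b ->
  meets v x a b -> meets v y a b -> (v = a \/ v = b) \/ (a = x /\ b = y) \/ (a = y /\ b = x).
Proof.
by move=> h1 h2 h3 h4 /meetsP m1 /meetsP m2; intuition (subst; try congruence; auto).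
Qed.

(* Two sets through [v] and a third one avoiding [v] form a triangle, which no two
   further distinct sets can meet. *)
Lemma star_center v x y a2 b2 a3 b3 a b :
  v <> x -> v <> y -> x <> y -> a2 <> b2 -> a3 <> b3 -> a <> b ->
  meets v x a2 b2 -> meets v y a2 b2 -> meets v x a3 b3 -> meets v y a3 b3 ->
  ~~ same v x a2 b2 -> ~~ same v y a2 b2 -> ~~ same v x a3 b3 -> ~~ same v y a3 b3 ->
  ~~ same a2 b2 a3 b3 ->
  meets v x a b -> meets v y a b -> meets a2 b2 a b -> meets a3 b3 a b -> v = a \/ v = b.
Proof.
move=> vx vy xy n2 n3 n m02 m12 m03 m13 /sameP d02 /sameP d12 /sameP d03 /sameP d13 /sameP d23 m0 m1 /meetsP m2 /meetsP m3.
case: (mem_or_third vx vy xy n m0 m1) => // t.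
(* If this pair contained [v], meeting {x, y} would make it {v, x} or {v, y}, a repetition. So it is
   {x, y}; the same holds for the next pair, and the two coincide. *)
have t2 : (a2 = x /\ b2 = y) \/ (a2 = y /\ b2 = x).
  case: (mem_or_third vx vy xy n2 m02 m12) => // s2; exfalso.
  by case: s2 => ?; subst; case: t => -[? ?]; subst; intuition (subst; congruence).
have t3 : (a3 = x /\ b3 = y) \/ (a3 = y /\ b3 = x).
  case: (mem_or_third vx vy xy n3 m03 m13) => // s3; exfalso.
  by case: s3 => ?; subst; case: t => -[? ?]; subst; intuition (subst; congruence).
by exfalso; case: t2 => -[? ?]; case: t3 => -[? ?]; subst; intuition congruence.
Qed.

(** Distinct pairs that meet share exactly one element; the conditional finds it by the same test as
    [center]. *)
Lemma pair_center a0 b0 a1 b1 : a0 <> b0 -> a1 <> b1 -> meets a0 b0 a1 b1 -> ~~ same a0 b0 a1 b1 ->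
  let v := if (a0 == a1) || (a0 == b1) then a0 else b0 in
  exists x y, [/\ v <> x, v <> y, x <> y,
   (a0 = v /\ b0 = x) \/ (a0 = x /\ b0 = v) & (a1 = v /\ b1 = y) \/ (a1 = y /\ b1 = v)].
Proof.
move=> n0 n1 /meetsP m /sameP d /=.
case: (a0 =P a1) => [e|ne] /=; first by exists b0, b1; split; intuition congruence.
case: (a0 =P b1) => [e|ne'] /=; first by exists b0, a1; split; intuition congruence.
case: m => [//|[//|[e|e]]].
- by exists a0, b1; split; intuition congruence.
- by exists a0, a1; split; intuition congruence.
Qed.

Lemma meetsC a b c d : meets a b c d = meets b a c d.
Proof. by rewrite /meets; case: (a == c); case: (a == d); case: (b == c); case: (b == d). Qed.
Lemma sameC a b c d : same a b c d = same b a c d.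
Proof. by rewrite /same; case: (a == c); case: (a == d); case: (b == c); case: (b == d). Qed.
End Pairs.

Lemma resize_id n p : size p = n -> resize n p = p.
Proof. by move=> <-; apply: mkseq_nth. Qed.

Lemma eval_resize C p : eval_circuit C (resize (c_in C) p) = eval_circuit C p.
Proof. by rewrite !eval_circuitE /wires (@resize_id _ (resize _ _)) ?size_mkseq. Qed.

Lemma all_flatten T (P : pred T) ss : all P (flatten ss) = all (all P) ss.
Proof. by elim: ss => //= s ss IH; rewrite all_cat IH. Qed.

Lemma all_descs P : all P descs -> forall i j, i < 6 -> j < 6 ->
  [/\ P (DInvalid i), P (DRepeat i j) & P (DDisjoint i j)].
Proof.
rewrite /descs all_flatten all_map => /allP h i j hi hj.
have hi' : i \in iota 0 6 by rewrite mem_iota.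
have hj' : j \in iota 0 6 by rewrite mem_iota.
have : P (DInvalid i) && all P (flatten [seq [:: DRepeat i j; DDisjoint i j] | j <- iota 0 6]) := h i hi'.
case/andP=> h1; rewrite all_flatten all_map => /allP /(_ j hj') /andP[h2 /andP[h3 _]].
by [].
Qed.

(** * Consequences of the failure of all candidates *)

Section Solutions.
Variables (C : circuit) (ho : size (c_outs C) = 2 * c_in C) (x y : seq bool).
Let n := c_in C.
Let v := center C.
Let q i := resize n (raw_index x y i).
Let a i := ekr_fst C (raw_index x y i).
Let b i := ekr_snd C (raw_index x y i).
Hypothesis none : ~~ has (holds C x y) descs.

Let none_holds i j : i < 6 -> j < 6 ->
  [/\ a i <> b i, q i != q j -> ~~ same (a i) (b i) (a j) (b j) & meets (a i) (b i) (a j) (b j)].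
Proof.
move=> hi hj; have := none; rewrite -all_predC => /all_descs /(_ i j hi hj) [h1 h2 h3].
split; [by apply/eqP | | exact: h3].
by move=> hq; move: h2; rewrite /= -/(q i) -/(q j) hq.
Qed.

Let valid i : i < 6 -> a i <> b i.
Proof. by move=> hi; have [] := none_holds hi hi. Qed.
Let distinct i j : i < 6 -> j < 6 -> q i != q j -> ~~ same (a i) (b i) (a j) (b j).
Proof. by move=> hi hj; have [] := none_holds hi hj. Qed.
Let meet i j : i < 6 -> j < 6 -> meets (a i) (b i) (a j) (b j).
Proof. by move=> hi hj; have [] := none_holds hi hj. Qed.

(** For n = 0 the only set is invalid; for n = 1 the only valid set is {0, 1}, so the indices 0 and
    1 repeat it. With n >= 2 the four fixed indices are distinct. *)
Lemma two_inputs : 1 < n.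
Proof.
have [sa0 sb0] := size_ekr (raw_index x y 0) ho; have [sa1 sb1] := size_ekr (raw_index x y 1) ho.
rewrite -/n -/(a 0) -/(b 0) -/(a 1) -/(b 1) in sa0 sb0 sa1 sb1.
case E : n => [|[|//]]; rewrite E in sa0 sb0 sa1 sb1.
  by case: (@valid 0 isT); rewrite (size0nil sa0) (size0nil sb0).
have := @valid 0 isT; have := @valid 1 isT; have := @distinct 0 1 isT isT.
rewrite /q E => /(_ isT).
case: (a 0) sa0 => [|[] [|]] //; case: (b 0) sb0 => [|[] [|]] //;
  case: (a 1) sa1 => [|[] [|]] //; by case: (b 1) sb1 => [|[] [|]].
Qed.

Let q_neq i j : i < 4 -> j < 4 -> i != j -> q i != q j.
Proof.
rewrite /q; case: n two_inputs => [|[|k]] // _; rewrite !resizeS.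
by case: i => [|[|[|[|]]]] //; case: j => [|[|[|[|]]]].
Qed.

(** The strings found may coincide with a fixed index, so of the k-th set the proof uses only that
    it is a genuine pair and meets the others. *)
Lemma mem_center k : k < 6 -> v = a k \/ v = b k.
Proof.
move=> hk.
have : exists X Y, [/\ v <> X, v <> Y, X <> Y,
   (a 0 = v /\ b 0 = X) \/ (a 0 = X /\ b 0 = v) & (a 1 = v /\ b 1 = Y) \/ (a 1 = Y /\ b 1 = v)].
  by apply: (pair_center (@valid 0 isT) (@valid 1 isT) (@meet 0 1 isT isT)); apply: distinct => //; apply: q_neq.
case=> X [Y [vX vY XY e0 e1]].
have m0 i : i < 6 -> meets v X (a i) (b i).
  by move=> hi; have := @meet 0 i isT hi; case: e0 => -[-> ->] //; rewrite meetsC.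
have m1 i : i < 6 -> meets v Y (a i) (b i).
  by move=> hi; have := @meet 1 i isT hi; case: e1 => -[-> ->] //; rewrite meetsC.
have d0 i : i < 4 -> 0 != i -> ~~ same v X (a i) (b i).
  move=> hi ni; have := @distinct 0 i isT ltac:(lia) (@q_neq 0 i isT hi ni).
  by case: e0 => -[-> ->] //; rewrite sameC.
have d1 i : i < 4 -> 1 != i -> ~~ same v Y (a i) (b i).
  move=> hi ni; have := @distinct 1 i isT ltac:(lia) (@q_neq 1 i isT hi ni).
  by case: e1 => -[-> ->] //; rewrite sameC.
apply: (@star_center _ v X Y (a 2) (b 2) (a 3) (b 3)) => //;
  try exact: valid; try exact: m0; try exact: m1; try exact: d0; try exact: d1; try exact: meet.
by apply: distinct => //; apply: q_neq.
Qed.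

Lemma eval_in_other k : k < 6 -> exists o, [/\ eval_circuit (in_circuit C) (raw_index x y k) = xors n o v,
  o <> v, size o = n & (a k = v /\ b k = o) \/ (a k = o /\ b k = v)].
Proof.
move=> hk; have ne := valid hk; have [sa sb] := size_ekr (raw_index x y k) ho.
rewrite eval_in // -/(a k) -/(b k) -/v -/n.
case: (mem_center hk) => e.
- exists (b k); rewrite e eqxx; split=> //; first by move=> e'; apply: ne.
  by left.
- exists (a k); rewrite e eqxx ifF; last by apply/eqP.
  by split=> //; right.
Qed.
End Solutions.

(** If all candidates failed, each value of the circuit would be [o] xor [v], with [o] the element
    other than [v]. It is nonzero because [o <> v], which excludes a zero; in a collision both sets
    have the same [o], so they repeat. *)
Lemma has_holds C s (H : size (c_outs (in_circuit C)) == c_in (in_circuit C)) :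
  size (c_outs C) = 2 * c_in C -> coll_valid (exist _ (in_circuit C) H) s ->
  has (holds C (coll_fst s) (coll_snd s)) descs.
Proof.
move=> ho hv; apply/negPn/negP => none; have sv := size_center ho.
have [o [e1 ov so h4]] := eval_in_other ho none (isT : 4 < 6).
have [o' [e2 ov' so' h5]] := eval_in_other ho none (isT : 5 < 6).
have [_ h _] : [/\ predC (holds C (coll_fst s) (coll_snd s)) (DInvalid 4),
    predC (holds C (coll_fst s) (coll_snd s)) (DRepeat 4 5) &
    predC (holds C (coll_fst s) (coll_snd s)) (DDisjoint 4 5)].
  by apply: (all_descs _ (isT : 4 < 6) (isT : 5 < 6)); rewrite all_predC.
case: s hv h e1 e2 h4 h5 {none} => [z|z z'] /=.
- move=> [_ e] _ e1 _ _ _; apply: ov; apply: (xors_inj so sv (v := center C)).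
  by rewrite -e1 xorsvv -e.
- move=> [sz [sz' [zz' e]]] h e1 e2 h4 h5.
  have eo : o = o' by apply: (xors_inj so so' (v := center C)); rewrite -e1 -e2.
  move: h; rewrite -[raw_index _ _ 4]/z -[raw_index _ _ 5]/z' !resize_id //.
  rewrite -[raw_index _ _ 4]/z -[raw_index _ _ 5]/z' in h4 h5.
  have -> : z != z' by apply/eqP.
  by case: h4 => -[-> ->]; case: h5 => -[-> ->]; rewrite eo !eqxx ?orbT.
Qed.

Lemma in_sol_valid C s (H0 : size (c_outs C) == 2 * c_in C)
    (H : size (c_outs (in_circuit C)) == c_in (in_circuit C)) :
  coll_valid (exist _ (in_circuit C) H) s ->
  ekr_valid (exist _ C H0) (in_sol C (coll_fst s) (coll_snd s)).
Proof.
move=> /(has_holds (eqP H0)); set x := coll_fst s; set y := coll_snd s => hh.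
have : holds C x y (head (DInvalid 0) (filter (holds C x y) descs)).
  by elim: descs hh => [//|d l IH] /=; case E: (holds C x y d).
rewrite /in_sol; move: (head _ _) => d.
have ef i : ekr_fst C (resize (c_in C) (raw_index x y i)) = ekr_fst C (raw_index x y i).
  by rewrite /ekr_fst eval_resize.
have es i : ekr_snd C (resize (c_in C) (raw_index x y i)) = ekr_snd C (raw_index x y i).
  by rewrite /ekr_snd eval_resize.
case: d => [i|i j|i j] /=; rewrite !ef !es ?size_mkseq.
- by move/eqP.
- case/andP=> /eqP ne /orP[] /andP[/eqP e1 /eqP e2]; do 3 split=> //; first by left.
  by right.
- by case/and4P=> /eqP ? /eqP ? /eqP ? /eqP ?.
Qed.

Lemma hard_outs C : size (c_outs C) == c_in C ->
  size (c_outs (hard_circuit C)) == 2 * c_in (hard_circuit C).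
Proof. by move/eqP=> h; rewrite /= size_cat size_nseq h mul2n addnn. Qed.

Lemma in_outs C : size (c_outs (in_circuit C)) == c_in (in_circuit C).
Proof. by rewrite size_map size_iota. Qed.

Theorem theorem10 : PPP_hard ErdosKoRado /\ in_PPP ErdosKoRado.
Proof.
split.
- exists (fun I : coll_inst => exist _ (hard_circuit (sval I)) (hard_outs (svalP I))).
  exists (fun (_ : coll_inst) s => hard_sol s).
  split; [|split].
  (* The registers number 16 in [regs]; the programs for membership add 8 to them for the instance
     map and 20 for the solution map. *)
  + eexists; split; first exact: (@cmd_poly_time 16 HardF).
    move=> [C hC]; apply: run_hardF; [exact/eqP | exact: leq_addr].
  + eexists; split; first exact: (@cmd_poly_time 16 HardG).
    by move=> [C hC] s; apply: run_hardG; exact: leq_addr.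
  + by move=> [C hC] s; apply: hard_sol_valid.
- exists (fun I : ekr_inst => exist _ (in_circuit (sval I)) (in_outs (sval I))).
  exists (fun (I : ekr_inst) s => in_sol (sval I) (coll_fst s) (coll_snd s)).
  split; [|split].
  + eexists; split; first by apply: (@cmd_poly_time 24 InF) => //; vm_compute.
    move=> [C hC]; apply: run_inF; [exact: leq_addl | exact/eqP | exact: leq_addr].
  + eexists; split; first by apply: (@cmd_poly_time 36 InG) => //; vm_compute.
    move=> [C hC] s; apply: run_inG; [exact/eqP | exact: leq_addr].
  + by move=> [C hC] s; apply: in_sol_valid.
Qed.
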